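(* Assume the following for every $n$. (1) $g_x^{(n)}$ and $g_y^{(n)}$ are strongly convex with parameter $\mu>0$ and continuously differentiable, and there is $L_g<\infty$ (independent of $n$) with $\|\nabla g_y^{(n)}(y)-\nabla g_y^{(n)}(y')\|\le L_g\|y-y'\|$ and $\|\nabla g_x^{(n)}(x)-\nabla g_x^{(n)}(x')\|\le L_g\|x-x'\|$ for all $y,y'\in\mathbb{R}^m$, $x,x'\in\mathbb{R}^d$. (2) $\mathcal{U}^{(n)}\subset\mathbb{R}^d$ is convex and compact, and $b_{\mathcal U}:=\sup_{n\ge 1}\sup_{u\in\mathcal{U}^{(n)}}\|u\|<\infty$. (3) $\{\Phi_n\}$ is i.i.d., and there is $\sigma_\Delta<\infty$ (independent of $n$) with $\mathsf{E}[\|A_{n+1}\|^4\mid\mathcal{F}_n]\le\sigma_\Delta^4$, $\mathsf{E}[\|b_{n+1}\|^4\mid\mathcal{F}_n]\le\sigma_\Delta^4$, and $\sup_n\|r_n\|\le\sigma_\Delta$. (4) For a constant $\varepsilon_m\ge 0$ (independent of $n$), $\mathsf{E}[\|\hat y_n-y_n\|^4\mid\mathcal{F}_n]\le\varepsilon_m^4$, $\mathsf{E}[\|\hat x_n-x_n\|^4\mid\mathcal{F}_n]\le\varepsilon_m^4$, and $\mathsf{E}[\|A^\circ_{n+1}-A_{n+1}\|^4\mid\mathcal{F}_n]\le\varepsilon_m^4$, where $\{A^\circ_{n+1}\}$ is a matrix-valued sequence constructed from $\{\hat x_n,u_n\}$. (5) The matrices $C\bar A$ and $\bar A$ have full column rank.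 Let $\{u_n\}$ be generated by $$u_{n+1}=\mathrm{Proj}_{\mathcal{U}^{(n)}}\{u_n-\alpha\nabla\hat\Gamma^{(n)}\},\qquad \nabla\hat\Gamma^{(n)}=(A^\circ_{n+1})^{\top}C^{\top}\nabla g_y^{(n)}(\hat y_n)+(A^\circ_{n+1})^{\top}\nabla g_x^{(n)}(\hat x_n).$$ Suppose in addition that there exists $\bar\gamma<\infty$ such that $\|u^*_{n+1}-u^*_n\|\le\bar\gamma$ for all $n$, and that the step-size satisfies $0<\alpha<\bar\mu_f/L_f^2$. Then there is a constant $b$, depending upon $b_{\mathcal U}$ and $L_f$, such that $$\limsup_{N\to\infty}\mathsf{E}[\|u_N-u_N^*\|^2]\le\alpha\,\epsilon_a+\epsilon_b+\frac1\alpha\Big[\epsilon_c+b_1\frac{\epsilon_c}{\alpha}\Big]+\frac{b_1}{\alpha^{3/2}}\sqrt{\epsilon_c[\alpha\epsilon_a+\epsilon_b]},$$ where $$\epsilon_a=\frac{1}{\bar\mu_f}b\,[2\sigma_f^2+\sigma_f],\quad \epsilon_b=\frac{1}{\bar\mu_f}b\,(\varepsilon_m+\alpha[2\varepsilon_m^2+\varepsilon_m]),\quad \epsilon_c=\frac{1}{\bar\mu_f}\bar\gamma^2,\quad b_1=\frac{4}{\bar\mu_f}.$$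
   Context: Setting. $\{\Phi_n\}$ is a sequence of random variables in a space $\mathsf{X}$; $A(\cdot)$ and $b(\cdot)$ are functions on $\mathsf X$ with values in $\mathbb{R}^{d\times d}$ and $\mathbb{R}^d$; $A_n=A(\Phi_n)$, $b_n=b(\Phi_n)$, $\bar A=\mathsf{E}[A(\Phi_n)]$. $C,D\in\mathbb{R}^{m\times d}$ are matrices and $\{r_n\}\subseteq\mathbb{R}^d$ is an exogenous disturbance sequence. Put $\varphi(u,\Phi)=A(\Phi)u+b(\Phi)$ and $h^{(n)}(x)=Cx+Dr_n$. For functions $g_x^{(n)}:\mathbb{R}^d\to\mathbb{R}$ and $g_y^{(n)}:\mathbb{R}^m\to\mathbb{R}$ define $f^{(n)}(u,\Phi)=g_x^{(n)}(\varphi(u,\Phi))+g_y^{(n)}(h^{(n)}(\varphi(u,\Phi)))$. $\mathcal{U}^{(n)}\subset\mathbb{R}^d$ is the constraint set at time $n$, and $u_n^*\in\arg\min_{u\in\mathcal{U}^{(n)}}\mathsf{E}[f^{(n)}(u,\Phi_{n+1})]$, the expectation being over $\Phi_{n+1}$. Along the iterates $\{u_n\}$ (with initial condition $u_0$ and constant step-size $\alpha>0$): $x_n=\varphi(u_n,\Phi_{n+1})$ is the actual input, $y_n=h^{(n)}(x_n)$ the output, and $\hat x_n,\hat y_n$ are measurements of $x_n,y_n$. $\mathrm{Proj}_{\mathcal U}$ is Euclidean projection onto $\mathcal U$. $\|\cdot\|$ is the Euclidean norm for vectors and the induced operator norm for matrices. $\mathcal{F}_n$ is the history of the algorithm up to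 time $n$, $\mathcal{F}_n=\{u_0,A_1,b_1,\dots,A_n,b_n\}$; $u_n$ is $\mathcal{F}_n$-measurable and $\Phi_{n+1}$ is independent of $\mathcal{F}_n$. Conditional inequalities hold almost surely. Write $\tilde u_n=u_n-u_n^*$ and $\nabla_u\tilde f^{(n)}(u_n,\Phi_{n+1})=\nabla_uf^{(n)}(u_n,\Phi_{n+1})-\nabla_uf^{(n)}(u_n^*,\Phi_{n+1})$. The constants $L_f<\infty$, $\bar\mu_f>0$, $\sigma_f\ge0$ are such that for each $n$: $\mathsf{E}[\|\nabla_u\tilde f^{(n)}(u_n,\Phi_{n+1})\|^2\mid\mathcal{F}_n]\le L_f^2\|\tilde u_n\|^2$; $\mathsf{E}[\nabla_u\tilde f^{(n)}(u_n,\Phi_{n+1})^{\top}\tilde u_n\mid\mathcal{F}_n]\ge\bar\mu_f\|\tilde u_n\|^2$; and $\mathsf{E}[\|\nabla_uf^{(n)}(u_n^*,\Phi_{n+1})-\mathsf{E}[\nabla_uf^{(n)}(u_n^*,\Phi_{n+1})]\|^2\mid\mathcal{F}_n]\le\sigma_f^2$.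
   Formalization: A b depending only on b_U and L_f is impossible. Here b may also depend on ε_m; if moreover the gradients of all g_x, g_y at 0 are bounded by some G, a b independent of ε_m is given, depending on b_U, L_f, L_g, σ_Δ, ‖C‖, ‖D‖, G. *)

(* Defs.v *)
From HB Require Import structures.
From mathcomp Require Import all_boot all_order all_algebra.
From mathcomp Require Import all_classical all_reals all_analysis.
From mathcomp Require Import measurable_realfun.

Set Implicit Arguments.
Unset Strict Implicit.
Unset Printing Implicit Defensive.

Import Order.TTheory GRing.Theory Num.Theory.
Import numFieldNormedType.Exports.

Local Open Scope classical_set_scope.
Local Open Scope ring_scope.

(* The norm that MathComp-Analysis puts on matrices is the max norm, so the
   Euclidean norm and the induced operator norm are defined here.  Both norms
   on 'cV[R]_p induce the same topology, hence the library's [compact],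
   [continuous] and [differentiable] are the usual ones on R^p. *)
Definition dotv (R : realType) (p : nat) (v w : 'cV[R]_p) : R :=
  (v^T *m w) 0 0.

Definition enorm (R : realType) (p : nat) (v : 'cV[R]_p) : R :=
  Num.sqrt (\sum_(i < p) v i 0 ^+ 2).

Definition opnorm (R : realType) (p q : nat) (M : 'M[R]_(p, q)) : R :=
  sup [set enorm (M *m v) | v in [set v : 'cV[R]_q | enorm v <= 1]].

Definition grad (R : realType) (p : nat) (g : 'cV[R]_p -> R) (x : 'cV[R]_p) :
    'cV[R]_p :=
  \col_(i < p) 'D_(delta_mx i 0) g x.

Definition continuously_differentiable (R : realType) (p : nat)
    (g : 'cV[R]_p -> R) : Prop :=
  (forall x, differentiable g x) /\ continuous (grad g).

Definition strongly_convex (R : realType) (p : nat) (mu : R)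
    (g : 'cV[R]_p -> R) : Prop :=
  forall (x y : 'cV[R]_p) (t : R), 0 <= t <= 1 ->
    g (t *: x + (1 - t) *: y) <=
      t * g x + (1 - t) * g y - mu / 2 * t * (1 - t) * enorm (x - y) ^+ 2.

Definition lipschitz_grad (R : realType) (p : nat) (L : R)
    (g : 'cV[R]_p -> R) : Prop :=
  forall x y, enorm (grad g x - grad g y) <= L * enorm (x - y).

(* [q] is the Euclidean projection of [v] onto [U]; it is unique when [U] is
   closed and convex. *)
Definition is_proj (R : realType) (p : nat) (U : set 'cV[R]_p)
    (v q : 'cV[R]_p) : Prop :=
  U q /\ forall z, U z -> enorm (v - q) <= enorm (v - z).

(* Events described by a single entry of a random matrix [Z]; they generate
   sigma(Z), since the Borel sigma-algebra of R^(p x q) is the product one. *)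
Definition entry_events (R : realType) (T : Type) (p q : nat)
    (Z : T -> 'M[R]_(p, q)) : set (set T) :=
  [set S | exists i j (B : set R),
     measurable B /\ S = (fun w => Z w i j) @^-1` B].

Definition mx_measurable (R : realType) (T : Type) (F : set (set T))
    (p q : nat) (Z : T -> 'M[R]_(p, q)) : Prop :=
  entry_events Z `<=` F.

(* sigma(u_0, A_1, b_1, ..., A_n, b_n); the values [As 0], [bs 0] are unused. *)
Definition history (R : realType) (T : Type) (p : nat) (u0 : T -> 'cV[R]_p)
    (As : nat -> T -> 'M[R]_p) (bs : nat -> T -> 'cV[R]_p) (n : nat) :
    set (set T) :=
  <<s entry_events u0 `|`
      \bigcup_(k in [set k | (0 < k <= n)%N])
        (entry_events (As k) `|` entry_events (bs k)) >>.

(* sigma(x_0, u_0, ..., x_n, u_n) *)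
Definition input_history (R : realType) (T : Type) (p : nat)
    (x u : nat -> T -> 'cV[R]_p) (n : nat) : set (set T) :=
  <<s \bigcup_(k in [set k | (k <= n)%N])
        (entry_events (x k) `|` entry_events (u k)) >>.

Section probability.
Context d (T : measurableType d) (R : realType) (P : probability T R).

(* Mutual independence (product rule over every finite subfamily) together
   with equality in law. *)
Definition iid d' (X : measurableType d') (Z : nat -> T -> X) : Prop :=
  (forall (J : seq nat) (S : nat -> set X), uniq J ->
     (forall j, measurable (S j)) ->
     P (\big[setI/setT]_(j <- J) (Z j @^-1` S j)) =
       (\prod_(j <- J) P (Z j @^-1` S j))%E) /\
  (forall n (S : set X), measurable S -> P (Z n @^-1` S) = P (Z 0%N @^-1` S)).

Definition indep_of d' (X : measurableType d') (Z : T -> X)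
    (F : set (set T)) : Prop :=
  forall (E : set T) (S : set X), F E -> measurable S ->
    P (E `&` Z @^-1` S) = (P E * P (Z @^-1` S))%E.

Definition expect_mx (p q : nat) (Z : T -> 'M[R]_(p, q)) : 'M[R]_(p, q) :=
  \matrix_(i, j) fine 'E_P[fun w => Z w i j].

(* [W] is a version of E[Z | F] for a nonnegative [Z]. *)
Definition condE_ge0 (F : set (set T)) (Z W : T -> \bar R) : Prop :=
  [/\ forall w, (0 <= W w)%E,
      forall B : set (\bar R), measurable B -> F (W @^-1` B) &
      forall E, F E -> (\int[P]_(w in E) W w = \int[P]_(w in E) Z w)%E].

(* [W] is a version of E[Z | F] = E[Z^+ | F] - E[Z^- | F], which is defined as
   soon as these two are not simultaneously infinite; for integrable [Z] this
   is the usual conditional expectation. *)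
Definition is_condE (F : set (set T)) (Z : T -> R) (W : T -> \bar R) : Prop :=
  (forall B : set (\bar R), measurable B -> F (W @^-1` B)) /\
  exists Wp Wn : T -> \bar R,
    [/\ condE_ge0 F (fun w => (Num.max (Z w) 0)%:E) Wp,
        condE_ge0 F (fun w => (Num.max (- Z w) 0)%:E) Wn &
        {ae P, forall w,
          ~ (Wp w = +oo%E /\ Wn w = +oo%E) /\ W w = (Wp w - Wn w)%E}].

(* E[Z | F] <= c and E[Z | F] >= c, almost surely. *)
Definition condE_le (F : set (set T)) (Z c : T -> R) : Prop :=
  exists W, is_condE F Z W /\ {ae P, forall w, (W w <= (c w)%:E)%E}.

Definition condE_ge (F : set (set T)) (Z c : T -> R) : Prop :=
  exists W, is_condE F Z W /\ {ae P, forall w, ((c w)%:E <= W w)%E}.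

End probability.

Section problem.
Context (R : realType) (m d : nat) (X : Type).
Variables (A : X -> 'M[R]_d) (b : X -> 'cV[R]_d).
Variables (C D : 'M[R]_(m, d)) (r : nat -> 'cV[R]_d).
Variables (gx : nat -> 'cV[R]_d -> R) (gy : nat -> 'cV[R]_m -> R).

Definition phi_map (v : 'cV[R]_d) (z : X) : 'cV[R]_d := A z *m v + b z.

Definition out_map (n : nat) (x : 'cV[R]_d) : 'cV[R]_m := C *m x + D *m r n.

Definition cost (n : nat) (v : 'cV[R]_d) (z : X) : R :=
  gx n (phi_map v z) + gy n (out_map n (phi_map v z)).

Definition grad_cost (n : nat) (v : 'cV[R]_d) (z : X) : 'cV[R]_d :=
  grad (fun v' => cost n v' z) v.

(* The feedback surrogate of [grad_cost], built from the estimate [Ao] of the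
   matrix and the measurements [xh], [yh]. *)
Definition grad_est (n : nat) (Ao : 'M[R]_d) (xh : 'cV[R]_d) (yh : 'cV[R]_m) :
    'cV[R]_d :=
  Ao^T *m C^T *m grad (gy n) yh + Ao^T *m grad (gx n) xh.

End problem.

Section bound.
Context (R : realType).
Variables (b alpha muf sigmaf epsm gammab : R).

Definition eps_a : R := muf^-1 * b * (2 * sigmaf ^+ 2 + sigmaf).
Definition eps_b : R :=
  muf^-1 * b * (epsm + alpha * (2 * epsm ^+ 2 + epsm)).
Definition eps_c : R := muf^-1 * gammab ^+ 2.
Definition b_one : R := 4 / muf.

Definition tracking_bound : R :=
  alpha * eps_a + eps_b
  + alpha^-1 * (eps_c + b_one * (eps_c / alpha))
  + b_one / (alpha `^ (3 / 2))
    * Num.sqrt (eps_c * (alpha * eps_a + eps_b)).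

End bound.

(* Main.v *)
(* The iterate u_n need not lie in U_n, so the optimality of ustar_n is not used
   through <grad E f, u_n - ustar_n> >= 0; instead ustar_n is the projection on
   U_n of ustar_n - alpha gbar_n, where gbar_n is the mean gradient at ustar_n,
   and projections are nonexpansive.  Hence |u_(n+1) - ustar_n| is at most
   |util_n - alpha (gradftil_n + Delta_n + Xi_n)|, with Delta_n the centered
   gradient noise at ustar_n, orthogonal to util_n by independence, and Xi_n the
   feedback error.  With e_n the root mean square error, a = alpha muf and
   V = alpha eps_a + eps_b, this gives
     e_(n+1) <= sqrt ((1 - a) e_n^2 + a V) + gammab,
   so that limsup e_n <= sqrt V + 2 gammab / a, whose square is below the
   claimed bound because a <= 1 (muf <= Lf unless every e_n vanishes).  Since
   V >= b epsm / muf and e_n <= 2 bU, the constant b can be chosen to make the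
   claim trivial once epsm is bounded below; the moment estimate of Xi_n is
   only needed for epsm <= 1. *)
Require Import Defs.
From HB Require Import structures.
From mathcomp Require Import all_boot all_order all_algebra.
From mathcomp Require Import all_classical all_reals all_analysis.
From mathcomp Require Import measurable_realfun.
From mathcomp Require Import ring lra.

Set Implicit Arguments.
Unset Strict Implicit.
Unset Printing Implicit Defensive.

Import Order.TTheory GRing.Theory Num.Theory.
Import numFieldNormedType.Exports.

Local Open Scope classical_set_scope.
Local Open Scope ring_scope.

(** The conditional hypotheses enter through their integrals over the whole space, so the recursion
    lives on plain expectations; the history reappears only with independence, in E <Delta_n,
    util_n> = 0. The recursion starts at time 2: u_(n+1) lies in U_n and b_U bounds U_n for n >= 1
    only, so u_2 is the first iterate known to have norm at most b_U, while the mean square of u_0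
    may be infinite. The fixed point property of ustar_n rests on <gbar_n, v - ustar_n> >= 0 for v
    in U_n. It is obtained without differentiating under the expectation: pointwise quadratic bounds
    on the cost along a segment are integrated instead. The recursion is written for root mean
    squares because Minkowski's inequality makes the motion of the target an additive term there,
    whereas squares would carry a cross term in e_n. Since V contains muf only as a factor muf^-1,
    the product a V is free of muf. Comparing it term by term with the errors of one step determines
    b. *)

Section euclidean.
Context (R : realType).
Implicit Types (p q : nat).

(** * Euclidean norm, operator norm and projections *)

Lemma dotvE p (v w : 'cV[R]_p) : dotv v w = \sum_i v i 0 * w i 0.
Proof. by rewrite /dotv mxE; apply: eq_bigr => i _; rewrite mxE. Qed.

Lemma dotvC p (v w : 'cV[R]_p) : dotv v w = dotv w v.
Proof. by rewrite !dotvE; apply: eq_bigr => i _; rewrite mulrC. Qed.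

Lemma dotvDl p (v w z : 'cV[R]_p) : dotv (v + w) z = dotv v z + dotv w z.
Proof. by rewrite /dotv linearD mulmxDl mxE. Qed.

Lemma dotvZl p a (v w : 'cV[R]_p) : dotv (a *: v) w = a * dotv v w.
Proof. by rewrite /dotv linearZ /= -scalemxAl mxE. Qed.

Lemma dotvNl p (v w : 'cV[R]_p) : dotv (- v) w = - dotv v w.
Proof. by rewrite -scaleN1r dotvZl mulN1r. Qed.

Lemma dotvDr p (v w z : 'cV[R]_p) : dotv v (w + z) = dotv v w + dotv v z.
Proof. by rewrite dotvC dotvDl !(dotvC v). Qed.

Lemma dotvZr p a (v w : 'cV[R]_p) : dotv v (a *: w) = a * dotv v w.
Proof. by rewrite dotvC dotvZl dotvC. Qed.

Lemma dotvNr p (v w : 'cV[R]_p) : dotv v (- w) = - dotv v w.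
Proof. by rewrite dotvC dotvNl dotvC. Qed.

Lemma dotv_mulmx p q (M : 'M[R]_(p, q)) v w :
  dotv v (M *m w) = dotv (M^T *m v) w.
Proof. by rewrite /dotv trmx_mul trmxK mulmxA. Qed.

Definition dotv_linE p :=
  (@dotvDl p, @dotvDr p, @dotvNl p, @dotvNr p, @dotvZl p, @dotvZr p).

Lemma enorm_ge0 p (v : 'cV[R]_p) : 0 <= enorm v.
Proof. exact: sqrtr_ge0. Qed.

Lemma sqr_enorm p (v : 'cV[R]_p) : enorm v ^+ 2 = dotv v v.
Proof.
rewrite sqr_sqrtr ?dotvE; last by apply: sumr_ge0 => i _; exact: sqr_ge0.
by apply: eq_bigr => i _; rewrite expr2.
Qed.

Lemma dotv_le p (v w : 'cV[R]_p) : dotv v w <= enorm v * enorm w.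
Proof.
have [w0|w0] := eqVneq (enorm w) 0.
  have /eqP : enorm w ^+ 2 = 0 by rewrite w0 expr0n.
  rewrite sqr_enorm dotvE psumr_eq0 => [/allP h|i _]; last by rewrite -expr2 sqr_ge0.
  rewrite w0 mulr0 dotvE big1// => i _.
  have := h i (mem_index_enum i); rewrite -expr2 sqrf_eq0 => /eqP ->.
  by rewrite mulr0.
have w1 : 0 < enorm w by rewrite lt0r w0 enorm_ge0.
have := enorm_ge0 (enorm w *: v - enorm v *: w).
(* This square equals 2 |v| |w| (|v| |w| - <v, w>); dividing by |v| |w| is why zero norms are
   treated apart. *)
have : 0 <= enorm (enorm w *: v - enorm v *: w) ^+ 2 by exact: sqr_ge0.
rewrite sqr_enorm !dotv_linE -!sqr_enorm (dotvC w v) => h _.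
have [v0|v0] := eqVneq (enorm v) 0.
  have /eqP : enorm v ^+ 2 = 0 by rewrite v0 expr0n.
  rewrite sqr_enorm dotvE psumr_eq0 => [/allP h'|i _]; last by rewrite -expr2 sqr_ge0.
  rewrite v0 mul0r dotvE big1// => i _.
  have := h' i (mem_index_enum i); rewrite -expr2 sqrf_eq0 => /eqP ->.
  by rewrite mul0r.
have v1 : 0 < enorm v by rewrite lt0r v0 enorm_ge0.
have vw : 0 < enorm v * enorm w by exact: mulr_gt0.
rewrite -(ler_pM2l vw); nra.
Qed.

Lemma normr_dotv_le p (v w : 'cV[R]_p) : `|dotv v w| <= enorm v * enorm w.
Proof.
rewrite ler_norml dotv_le andbT -lerN2 opprK -dotvNl (le_trans (dotv_le _ _))//.
suff -> : enorm (- v) = enorm v by [].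
by rewrite /enorm; congr Num.sqrt; apply: eq_bigr => i _; rewrite mxE sqrrN.
Qed.

Lemma enormN p (v : 'cV[R]_p) : enorm (- v) = enorm v.
Proof.
by rewrite /enorm; congr Num.sqrt; apply: eq_bigr => i _; rewrite mxE sqrrN.
Qed.

Lemma enorm0 p : enorm (0 : 'cV[R]_p) = 0.
Proof.
by rewrite /enorm big1 ?sqrtr0// => i _; rewrite mxE expr0n.
Qed.

Lemma enorm_eq0 p (v : 'cV[R]_p) : enorm v = 0 -> v = 0.
Proof.
move=> v0; have /eqP : enorm v ^+ 2 = 0 by rewrite v0 expr0n.
rewrite sqr_enorm dotvE psumr_eq0 => [/allP h|i _]; last by rewrite -expr2 sqr_ge0.
apply/colP => i; have := h i (mem_index_enum i).
by rewrite -expr2 sqrf_eq0 mxE => /eqP ->.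
Qed.

Lemma enormZ p a (v : 'cV[R]_p) : enorm (a *: v) = `|a| * enorm v.
Proof.
apply/eqP; rewrite -(@eqrXn2 _ 2)//; try by rewrite ?mulr_ge0 ?enorm_ge0.
by rewrite sqr_enorm !dotv_linE -sqr_enorm exprMn real_normK ?num_real// mulrA.
Qed.

Lemma ler_enormD p (v w : 'cV[R]_p) : enorm (v + w) <= enorm v + enorm w.
Proof.
rewrite -(@ler_pXn2r _ 2) ?nnegrE ?addr_ge0 ?enorm_ge0//.
rewrite sqr_enorm !dotv_linE -!sqr_enorm (dotvC w v).
have := dotv_le v w; lra.
Qed.

Lemma ler_enormB p (v w : 'cV[R]_p) : enorm (v - w) <= enorm v + enorm w.
Proof. by rewrite (le_trans (ler_enormD _ _))// enormN. Qed.

Lemma sqr_enormB p (v w : 'cV[R]_p) :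
  enorm (v - w) ^+ 2 = enorm v ^+ 2 - 2 * dotv v w + enorm w ^+ 2.
Proof. by rewrite !sqr_enorm !dotv_linE (dotvC w v); ring. Qed.

Lemma normr_coord_le_enorm p (v : 'cV[R]_p) i : `|v i 0| <= enorm v.
Proof.
rewrite -(@ler_pXn2r _ 2) ?nnegrE ?enorm_ge0//.
rewrite sqr_enorm dotvE (bigD1 i)//= real_normK ?num_real// expr2 lerDl.
by apply: sumr_ge0 => j _; rewrite -expr2 sqr_ge0.
Qed.

(** Cauchy-Schwarz row by row. The Frobenius norm makes the supremum in [opnorm] finite, and it
    controls [opnorm] by the entries in [opnorm_continuous]. *)
Lemma enorm_mulmx_frobenius p q (M : 'M[R]_(p, q)) v :
  enorm (M *m v) <= Num.sqrt (\sum_i \sum_j M i j ^+ 2) * enorm v.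
Proof.
have F0 : 0 <= \sum_i \sum_j M i j ^+ 2.
  by apply: sumr_ge0 => i _; apply: sumr_ge0 => j _; exact: sqr_ge0.
rewrite -(@ler_pXn2r _ 2) ?nnegrE ?mulr_ge0 ?enorm_ge0 ?sqrtr_ge0//.
rewrite exprMn (sqr_sqrtr F0) [leLHS]sqr_enorm dotvE mulr_suml; apply: ler_sum => i _.
have -> : (M *m v) i 0 = dotv (row i M)^T v.
  by rewrite dotvE mxE; apply: eq_bigr => j _; rewrite !mxE.
rewrite -expr2 -(real_normK (num_real _)).
have -> : \sum_j M i j ^+ 2 = enorm (row i M)^T ^+ 2.
  by rewrite sqr_enorm dotvE; apply: eq_bigr => j _; rewrite !mxE expr2.
by rewrite -exprMn ler_pXn2r ?nnegrE ?mulr_ge0 ?enorm_ge0// normr_dotv_le.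
Qed.

Lemma opnorm_has_sup p q (M : 'M[R]_(p, q)) :
  has_sup [set enorm (M *m v) | v in [set v : 'cV[R]_q | enorm v <= 1]].
Proof.
split; first by exists (enorm (M *m 0)), 0; rewrite //= enorm0.
exists (Num.sqrt (\sum_i \sum_j M i j ^+ 2)) => _ [v /= v1 <-].
rewrite (le_trans (enorm_mulmx_frobenius _ _))//.
by rewrite ler_piMr ?sqrtr_ge0.
Qed.

Lemma opnorm_ge0 p q (M : 'M[R]_(p, q)) : 0 <= opnorm M.
Proof.
apply: (@le_trans _ _ (enorm (M *m 0))); first exact: enorm_ge0.
apply: ub_le_sup; first by have [] := opnorm_has_sup M.
by exists 0; rewrite //= enorm0.
Qed.

Lemma enorm_mulmx p q (M : 'M[R]_(p, q)) v :
  enorm (M *m v) <= opnorm M * enorm v.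
Proof.
have [v0|v0] := eqVneq (enorm v) 0.
  by rewrite (enorm_eq0 v0) mulmx0 !enorm0 mulr0.
have v1 : 0 < enorm v by rewrite lt0r v0 enorm_ge0.
rewrite -ler_pdivrMr// mulrC.
have -> : (enorm v)^-1 * enorm (M *m v) = enorm (M *m ((enorm v)^-1 *: v)).
  by rewrite -scalemxAr enormZ ger0_norm// invr_ge0 ltW.
apply: ub_le_sup; first by have [] := opnorm_has_sup M.
exists ((enorm v)^-1 *: v) => //=.
by rewrite enormZ ger0_norm ?mulVf// invr_ge0 ltW.
Qed.

Lemma opnorm_le p q (M : 'M[R]_(p, q)) c : 0 <= c ->
  (forall v, enorm (M *m v) <= c * enorm v) -> opnorm M <= c.
Proof.
move=> c0 h; apply: ge_sup; first by have [] := opnorm_has_sup M.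
by move=> _ [v /= v1 <-]; rewrite (le_trans (h v))// ler_piMr.
Qed.

Lemma ler_opnormD p q (M N : 'M[R]_(p, q)) :
  opnorm (M + N) <= opnorm M + opnorm N.
Proof.
apply: opnorm_le => [|v]; first by rewrite addr_ge0 ?opnorm_ge0.
by rewrite mulmxDl mulrDl (le_trans (ler_enormD _ _))// lerD ?enorm_mulmx.
Qed.

(** The feedback multiplies by A^T whereas the moments are those of A. Here |M^T v|^2 = <v, M M^T v>
    <= |v| |M| |M^T v|, and one factor cancels. *)
Lemma enorm_trmx_mulmx p q (M : 'M[R]_(p, q)) v :
  enorm (M^T *m v) <= opnorm M * enorm v.
Proof.
have [z|z] := eqVneq (enorm (M^T *m v)) 0.
  by rewrite z mulr_ge0 ?opnorm_ge0 ?enorm_ge0.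
have z1 : 0 < enorm (M^T *m v) by rewrite lt0r z enorm_ge0.
rewrite -(ler_pM2r z1) -expr2 sqr_enorm -dotv_mulmx.
by rewrite (le_trans (dotv_le _ _))// -mulrA mulrCA ler_wpM2l ?enorm_ge0 ?enorm_mulmx.
Qed.

Lemma convex_set_segment p (U : set 'cV[R]_p) x y t :
  convex_set U -> U x -> U y -> 0 <= t <= 1 -> U (t *: x + (1 - t) *: y).
Proof.
move=> cU Ux Uy t01.
(* [convex_set] quantifies over scalars typed in [0, 1]; this packs the real [t] into that type. *)
have tP : Itv.spec (@Itv.num_sem R) (Itv.Real `[0%Z, 1%Z]) t.
  by rewrite /Itv.spec /Itv.num_sem /= num_real/= in_itv/=.
by have := cU x y (Itv.mk tP); rewrite !inE; apply.
Qed.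

(* With q the projection of v, <v - q, q' - q> <= 0; adding the hypothesis at
   z = q gives |q - q'|^2 <= <v - v', q - q'>. *)
Lemma is_proj_dist p (U : set 'cV[R]_p) (v v' q q' : 'cV[R]_p) :
  convex_set U -> is_proj U v q -> U q' ->
  (forall z, U z -> dotv (v' - q') (z - q') <= 0) ->
  enorm (q - q') ^+ 2 <= enorm (v - v') ^+ 2.
Proof.
move=> cU [Uq hq] Uq' hq'.
have vq : dotv (v - q) (q' - q) <= 0.
  set e := dotv (v - q) (q' - q); set n := enorm (q' - q) ^+ 2.
  have n0 : 0 <= n by exact: sqr_ge0.
  have key t : 0 < t -> t < 1 -> 2 * e <= t * n.
    move=> t0 t1.
    have Uz : U (t *: q' + (1 - t) *: q).
      by apply: convex_set_segment => //; rewrite !ltW.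
    have := hq _ Uz.
    have -> : v - (t *: q' + (1 - t) *: q) = (v - q) - t *: (q' - q).
      by apply/matrixP => i j; rewrite !mxE; ring.
    rewrite -(@ler_pXn2r _ 2) ?nnegrE ?enorm_ge0// [leRHS]sqr_enormB.
    rewrite dotvZr enormZ exprMn real_normK ?num_real// -/e -/n => h.
    by rewrite -(ler_pM2l t0); nra.
  have [//|e0] := leP e 0.
  (* For e > 0 this choice gives t n = n e / (n + e) <= e < 2 e, against [key]; n = 0 is set apart
     because then t = 1. *)
  pose t := e / (n + e).
  have ne : 0 < n + e by rewrite ltr_wpDl.
  have t0 : 0 < t by rewrite divr_gt0.
  have tE : t * (n + e) = e by rewrite /t divfK ?gt_eqF.
  have [n00|n00] := eqVneq n 0; first by have := key 2^-1; rewrite n00; nra.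
  have n1 : 0 < n by rewrite lt0r n00.
  have t1 : t < 1 by rewrite /t ltr_pdivrMr// mul1r ltrDr.
  have := key t t0 t1; nra.
have := hq' _ Uq.
have : 0 <= enorm ((v - v') - (q - q')) ^+ 2 by exact: sqr_ge0.
have -> : v' - q' = (v - q) - ((v - v') - (q - q')).
  by apply/matrixP => i j; rewrite !mxE; ring.
move: vq; have -> : q' - q = - (q - q') by rewrite opprB.
move: (v - q) (v - v') (q - q') => a c e.
by rewrite !sqr_enorm !dotv_linE (dotvC e c); lra.
Qed.

End euclidean.

(** * Measurability of random vectors and matrices *)

Section measurability.
Context d (T : measurableType d) (R : realType).
Implicit Types (p q : nat).

Lemma mx_measurableP p q (Z : T -> 'M[R]_(p, q)) :
  mx_measurable measurable Z <->
  forall i j, measurable_fun setT (fun w => Z w i j).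
Proof.
split=> [mZ i j _ B mB|mZ S [i [j [B [mB ->]]]]].
  by rewrite setTI; apply: mZ; exists i, j, B.
by rewrite -[X in measurable X]setTI; exact: mZ.
Qed.

(* An open set is the union of the boxes with rational centers and inverse
   integer radii that it contains. *)
Lemma measurable_continuous_comp_mx p q (h : 'M[R]_(p, q) -> R)
    (Z : T -> 'M[R]_(p, q)) :
  continuous h -> mx_measurable measurable Z ->
  measurable_fun setT (fun w => h (Z w)).
Proof.
move=> ch /mx_measurableP mZ.
apply: (measurability _ (RGenOInfty.measurableE R)).
move=> _ [_ [a ->] <-]; rewrite setTI.
pose box (c : 'M[rat]_(p, q)) (k : nat) : set 'M[R]_(p, q) :=
  [set y | forall i j, `|y i j - ratr (c i j)| < k.+1%:R^-1].
(* Boxes are indexed by the codes of pairs (center, k), which makes the union countable; [J] selects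
   those inside the open set. *)
pose J : set nat := [set n | if unpickle n is Some ck
  then box ck.1 ck.2 `<=` [set y | a < h y] else False].
pose F n := if unpickle n is Some ck then Z @^-1` box ck.1 ck.2 else set0.
suff -> : (fun w => h (Z w)) @^-1` `]a, +oo[ = \bigcup_(n in J) F n.
  apply: bigcup_measurable => n _; rewrite /F.
  case: unpickle => [[c k]|//]; rewrite /=.
  have -> : Z @^-1` box c k = \bigcap_(ij in [set: 'I_p * 'I_q])
      ((fun w => `|Z w ij.1 ij.2 - ratr (c ij.1 ij.2)|) @^-1`
        `]-oo, k.+1%:R^-1[).
    apply/seteqP; split=> [w h' [i j] _ /=|w h' i j /=].
      by rewrite in_itv/=; exact: h'.
    by have := h' (i, j) Logic.I; rewrite /= in_itv/=.
  apply: fin_bigcap_measurable => // -[i j] _.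
  rewrite -[X in measurable X]setTI.
  by apply: measurableT_comp => //; apply: measurable_funB => //; exact: mZ.
apply/seteqP; split=> [w /=|w [n]].
  rewrite in_itv/= andbT => aw.
  have op : open [set y | a < h y].
    rewrite (_ : [set y | _] = h @^-1` `]a, +oo[); last first.
      by apply/seteqP; split=> y /=; rewrite in_itv/= andbT.
    by apply: open_comp => [y _|]; [exact: ch|exact: interval_open].
  have /nbhs_ballP[e /= e0 he] : nbhs (Z w) [set y | a < h y].
    by move: op; rewrite openE; apply.
  (* Half of [e]: a point of the box and [Z w] are both within the radius of the center, hence
     within twice the radius of each other. *)
  have [k ke] : exists k, k.+1%:R^-1 < e / 2.
    have e2 : 0 < e / 2 by rewrite divr_gt0.
    have [k _ /(_ k (leqnn k)) /= ?] := near_infty_natSinv_lt (PosNum e2).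
    by exists k.
  have hc i j : exists c : rat, `|Z w i j - ratr c| < k.+1%:R^-1.
    have /rat_in_itvoo[c] : Z w i j - k.+1%:R^-1 < Z w i j + k.+1%:R^-1.
      by rewrite ltrBlDr -addrA ltrDl addr_gt0 ?invr_gt0.
    by rewrite in_itv/= => ?; exists c; rewrite ltr_distlC.
  pose c := \matrix_(i, j) xchoose (hc i j).
  exists (pickle (c, k)); rewrite /J /F /= pickleK /=; last first.
    by move=> i j; rewrite [c i j]mxE; exact: (xchooseP (hc i j)).
  move=> y hy; apply: he; split=> // i j.
  rewrite /ball/=.
  have := hy i j; have := xchooseP (hc i j); rewrite [c i j]mxE.
  move: (xchoose _) ke => r; move: (k.+1%:R^-1) => s ?.
  rewrite !ltr_distlC => /andP[? ?] /andP[? ?].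
  by apply/andP; split; lra.
rewrite /J /F /=; case: unpickle => [[c k] /= h1 h2|//].
by rewrite in_itv/= andbT; exact: h1.
Qed.

Lemma mx_measurable_cst p q (M : 'M[R]_(p, q)) :
  mx_measurable measurable (fun _ : T => M).
Proof. by apply/mx_measurableP => i j; exact: measurable_cst. Qed.

Lemma mx_measurableD p q (Y Z : T -> 'M[R]_(p, q)) :
  mx_measurable measurable Y -> mx_measurable measurable Z ->
  mx_measurable measurable (fun w => Y w + Z w).
Proof.
move=> /mx_measurableP mY /mx_measurableP mZ; apply/mx_measurableP => i j.
under eq_fun do rewrite mxE.
exact: measurable_funD.
Qed.

Lemma mx_measurableZ p q (a : R) (Z : T -> 'M[R]_(p, q)) :
  mx_measurable measurable Z -> mx_measurable measurable (fun w => a *: Z w).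
Proof.
move=> /mx_measurableP mZ; apply/mx_measurableP => i j.
under eq_fun do rewrite mxE.
by apply: measurable_funM => //; exact: measurable_cst.
Qed.

Lemma mx_measurableB p q (Y Z : T -> 'M[R]_(p, q)) :
  mx_measurable measurable Y -> mx_measurable measurable Z ->
  mx_measurable measurable (fun w => Y w - Z w).
Proof.
move=> mY mZ; under eq_fun do rewrite -scaleN1r.
by apply: mx_measurableD => //; exact: mx_measurableZ.
Qed.

Lemma mx_measurable_trmx p q (Z : T -> 'M[R]_(p, q)) :
  mx_measurable measurable Z -> mx_measurable measurable (fun w => (Z w)^T).
Proof.
move=> /mx_measurableP mZ; apply/mx_measurableP => i j.
under eq_fun do rewrite mxE.
exact: mZ.
Qed.

Lemma mx_measurableM p q s (Y : T -> 'M[R]_(p, q)) (Z : T -> 'M[R]_(q, s)) :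
  mx_measurable measurable Y -> mx_measurable measurable Z ->
  mx_measurable measurable (fun w => Y w *m Z w).
Proof.
move=> /mx_measurableP mY /mx_measurableP mZ; apply/mx_measurableP => i j.
under eq_fun do rewrite mxE.
by apply: measurable_sum => k; exact: measurable_funM.
Qed.

Lemma measurable_dotv p (Y Z : T -> 'cV[R]_p) :
  mx_measurable measurable Y -> mx_measurable measurable Z ->
  measurable_fun setT (fun w => dotv (Y w) (Z w)).
Proof.
move=> mY mZ; have /mx_measurableP := mx_measurableM (mx_measurable_trmx mY) mZ.
by move=> /(_ 0 0).
Qed.

Lemma measurable_enorm p (Z : T -> 'cV[R]_p) :
  mx_measurable measurable Z -> measurable_fun setT (fun w => enorm (Z w)).
Proof.
move=> mZ.
under eq_fun do rewrite -(ger0_norm (enorm_ge0 _)) -sqrtr_sqr sqr_enorm.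
apply: measurableT_comp; last exact: measurable_dotv.
apply: continuous_measurable_fun; exact: sqrt_continuous.
Qed.

(** Makes [opnorm] of a random matrix measurable although it is a supremum over uncountably many
    vectors. The triangle inequality, used both ways, leaves the norm of a difference, which its
    entries control. *)
Lemma opnorm_continuous p q : continuous (@opnorm R p q).
Proof.
move=> M S /nbhs_ballP[e2 /= e20 hS].
pose e := e2 / 2; have e0 : 0 < e by rewrite divr_gt0.
(* Entries at most e / K give a Frobenius norm at most e sqrt (p q) / K <= e; adding 1 keeps [K]
   positive for empty matrices. *)
pose K : R := Num.sqrt (p * q)%:R + 1.
have K0 : 0 < K by rewrite ltr_wpDl ?sqrtr_ge0.
have dist (M1 M2 : 'M[R]_(p, q)) : (forall i j, `|M1 i j - M2 i j| <= e / K) ->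
    opnorm M1 <= opnorm M2 + e.
  move=> h; rewrite -(subrK M2 M1) addrC (le_trans (ler_opnormD _ _))// lerD2l.
  apply: opnorm_le => [|v]; first exact: ltW.
  rewrite (le_trans (enorm_mulmx_frobenius _ _))// ler_wpM2r ?enorm_ge0//.
  rewrite -(@ler_pXn2r _ 2) ?nnegrE ?sqrtr_ge0 ?(ltW e0)// sqr_sqrtr; last first.
    by apply: sumr_ge0 => i _; apply: sumr_ge0 => j _; exact: sqr_ge0.
  have eK : 0 <= e / K by rewrite divr_ge0// ltW.
  have : \sum_(i < p) \sum_(j < q) (M1 - M2) i j ^+ 2 <=
      \sum_(i < p) \sum_(j < q) (e / K) ^+ 2.
    apply: ler_sum => i _; apply: ler_sum => j _.
    rewrite !mxE -(real_normK (num_real (M1 i j - M2 i j))).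
    by rewrite ler_pXn2r ?nnegrE ?normr_ge0.
  move=> /le_trans; apply.
  rewrite !sumr_const !card_ord -mulrnA -mulr_natr mulnC expr_div_n -mulrA.
  rewrite ler_piMr ?sqr_ge0// mulrC ler_pdivrMr ?exprn_gt0// mul1r /K.
  by rewrite sqrrD sqr_sqrtr ?ler0n// -addrA lerDl addr_ge0.
have eK : 0 < e / K by rewrite divr_gt0.
apply/nbhs_ballP; exists (e / K) => //= N [_ hN].
have h i j : `|M i j - N i j| <= e / K by exact/ltW/hN.
apply: hS; rewrite /ball/= (@le_lt_trans _ _ e)//; last by rewrite /e; lra.
rewrite ler_distlC lerBlDr; apply/andP; split; last first.
  by apply: dist => i j; rewrite distrC.
by rewrite dist.
Qed.

Lemma measurable_opnorm p q (Z : T -> 'M[R]_(p, q)) :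
  mx_measurable measurable Z -> measurable_fun setT (fun w => opnorm (Z w)).
Proof. exact/measurable_continuous_comp_mx/opnorm_continuous. Qed.

Lemma mx_measurable_continuous_comp p q (G : 'cV[R]_p -> 'cV[R]_q)
    (Z : T -> 'cV[R]_p) :
  continuous G -> mx_measurable measurable Z ->
  mx_measurable measurable (fun w => G (Z w)).
Proof.
move=> cG mZ; apply/mx_measurableP => i j.
apply: (@measurable_continuous_comp_mx _ _ (fun x => G x i j)) => // x.
apply: (@continuous_comp _ _ _ G (fun M : 'cV[R]_q => M i j)); first exact: cG.
exact: coord_continuous.
Qed.

End measurability.

(** * Expectations, conditional bounds and independence *)

Section probability.
Context d (T : measurableType d) (R : realType) (P : probability T R).
Implicit Types (f g h : T -> R) (F : set (set T)).

Local Notation int f := (P.-integrable setT (EFin \o f%R)).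
Local Notation Ex f := (Rintegral P setT f%R).

Lemma integrable_cst (c : R) : int (fun=> c).
Proof. by have := @finite_measure_integrable_cst _ _ _ P setT c; apply. Qed.

Lemma integrable_add f g : int f -> int g -> int (fun w => f w + g w).
Proof. exact: integrableD. Qed.

Lemma integrable_scale (k : R) f : int f -> int (fun w => k * f w).
Proof. exact: integrableZl. Qed.

Lemma integrable_le f g : measurable_fun setT f ->
  (forall w, `|f w| <= g w) -> int g -> int f.
Proof.
move=> mf fg; apply: le_integrable => //; first exact/measurable_EFinP.
by move=> w _ /=; rewrite lee_fin (le_trans (fg w))// ler_norm.
Qed.

Lemma Rintegral_prob_cst (c : R) : Ex (fun=> c) = c.
Proof. by rewrite Rintegral_cst//= probability_setT mulr1. Qed.

Lemma EFin_Rintegral f : int f -> (Ex f)%:E = (\int[P]_w (f w)%:E)%E.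
Proof. by move=> fi; rewrite /Rintegral fineK// integrable_fin_num. Qed.

Lemma Rintegral_le f g : int f -> int g -> (forall w, f w <= g w) ->
  Ex f <= Ex g.
Proof. by move=> fi gi fg; apply: le_Rintegral. Qed.

Lemma Rintegral_ge0_le f (c : R) : measurable_fun setT f ->
  (forall w, 0 <= f w) -> 0 <= c -> (\int[P]_w (f w)%:E <= c%:E)%E ->
  int f /\ Ex f <= c.
Proof.
move=> mf f0 c0 fc.
have fi : int f.
  apply/integrableP; split; first exact/measurable_EFinP.
  under eq_integral do rewrite /= ger0_norm//.
  by rewrite (le_lt_trans fc)// ltry.
by split=> //; rewrite -lee_fin EFin_Rintegral.
Qed.

(* Young's inequality 2|fg| <= s f^2 + s^-1 g^2 with the optimal s = b / a. *)
Lemma Rintegral_cauchy_schwarz f g (a b : R) :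
  measurable_fun setT f -> measurable_fun setT g -> 0 <= a -> 0 <= b ->
  int (fun w => f w ^+ 2) -> int (fun w => g w ^+ 2) ->
  Ex (fun w => f w ^+ 2) <= a ^+ 2 -> Ex (fun w => g w ^+ 2) <= b ^+ 2 ->
  int (fun w => `|f w| * `|g w|) /\ Ex (fun w => `|f w| * `|g w|) <= a * b.
Proof.
move=> mf mg a0 b0 fi gi fa gb.
have fgi : int (fun w => `|f w| * `|g w|).
  apply: integrable_le (integrable_add fi gi) => [|w].
    by apply: measurable_funM; exact: measurableT_comp.
  rewrite ger0_norm ?mulr_ge0// -(real_normK (num_real (f w))).
  by rewrite -(real_normK (num_real (g w))); nra.
split=> //.
have young s : 0 < s -> 2 * Ex (fun w => `|f w| * `|g w|) <= s * a ^+ 2 + s^-1 * b ^+ 2.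
  move=> s0; have s10 : 0 < s^-1 by rewrite invr_gt0.
  have -> : 2 * Ex (fun w => `|f w| * `|g w|) = Ex (fun w => 2 * (`|f w| * `|g w|)).
    by rewrite RintegralZl.
  apply: (@le_trans _ _ (Ex (fun w => s * f w ^+ 2 + s^-1 * g w ^+ 2))).
    apply: Rintegral_le => [||w]; first exact: integrable_scale.
      by apply: integrable_add; exact: integrable_scale.
    rewrite -(real_normK (num_real (f w))) -(real_normK (num_real (g w))).
    have ss : s * s^-1 = 1 by rewrite divff ?gt_eqF.
    have := sqr_ge0 (s * `|f w| - `|g w|) => h.
    rewrite -(ler_pM2l s0) mulrDr !mulrA ss mul1r; nra.
  rewrite RintegralD//; try exact: integrable_scale.
  by rewrite !RintegralZl// lerD// ler_pM2l.
have [a00|a00] := eqVneq a 0.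
  rewrite a00 mul0r leNgt; apply/negP => x0.
  set x := Ex _ in young x0.
  (* The optimal s is out of reach when a = 0; this value already gives 2 x <= x b^2 / (b^2 + 1),
     which is absurd. The case b = 0 is symmetric. *)
  have s0 : 0 < (b ^+ 2 + 1) / x by rewrite divr_gt0// ltr_wpDl ?sqr_ge0.
  have := young _ s0; rewrite a00 expr0n mulr0 add0r invf_div leNgt => /negP; apply.
  rewrite -mulrA mulrC; apply: (@le_lt_trans _ _ x); last lra.
  by rewrite ler_piMl ?(ltW x0)// mulrC ler_pdivrMr ?mul1r ?lerDl// ltr_wpDl ?sqr_ge0.
have [b00|b00] := eqVneq b 0.
  rewrite b00 mulr0 leNgt; apply/negP => x0.
  set x := Ex _ in young x0.
  have s0 : 0 < x / (a ^+ 2 + 1) by rewrite divr_gt0// ltr_wpDl ?sqr_ge0.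
  have := young _ s0; rewrite b00 expr0n mulr0 addr0 leNgt => /negP; apply.
  rewrite -mulrA; apply: (@le_lt_trans _ _ x); last lra.
  by rewrite ler_piMr ?(ltW x0)// mulrC ler_pdivrMr ?mul1r ?lerDl// ltr_wpDl ?sqr_ge0.
have a1 : 0 < a by rewrite lt0r a00.
have b1 : 0 < b by rewrite lt0r b00.
have := young _ (divr_gt0 b1 a1).
have -> : b / a * a ^+ 2 + (b / a)^-1 * b ^+ 2 = 2 * (a * b).
  by field; rewrite a00 b00.
by rewrite ler_pM2l.
Qed.

(** Cauchy-Schwarz against the constant 1. *)
Lemma Rintegral_sqr_ge f : int (fun w => f w ^+ 2) -> measurable_fun setT f ->
  (forall w, 0 <= f w) ->
  int f /\ Ex f <= Num.sqrt (Ex (fun w => f w ^+ 2)).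
Proof.
move=> fi mf f0; set s := Num.sqrt _.
have e0 : 0 <= Ex (fun w => f w ^+ 2) by apply: Rintegral_ge0 => w _; exact: sqr_ge0.
have h1 : Ex (fun w => f w ^+ 2) <= s ^+ 2 by rewrite sqr_sqrtr.
have h2 : Ex (fun=> 1 ^+ 2) <= 1 ^+ 2 by rewrite Rintegral_prob_cst.
have [] := Rintegral_cauchy_schwarz mf (measurable_cst (1 : R)) (sqrtr_ge0 _)
  ler01 fi (integrable_cst (1 ^+ 2)) h1 h2.
rewrite mulr1 (_ : (fun w => _) = f)//.
by apply/funext => w; rewrite normr1 mulr1 ger0_norm.
Qed.

Lemma condE_ge0_measurable F (Z W : T -> \bar R) : F `<=` measurable ->
  condE_ge0 P F Z W -> measurable_fun setT W.
Proof. by move=> Fm [_ mW _] _ B mB; rewrite setTI; apply/Fm/mW. Qed.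

(** As [Z] is nonnegative, [Wn] has integral 0 and vanishes almost everywhere; so [W] agrees with
    [Wp], whose integral over the whole space is that of [Z]. Integrability of [Z] is thus a
    conclusion, inherited from [c]. *)
Lemma condE_le_Rintegral F (Z c : T -> R) : F setT -> F `<=` measurable ->
  measurable_fun setT Z -> (forall w, 0 <= Z w) ->
  (forall w, 0 <= c w) -> int c ->
  condE_le P F Z c -> int Z /\ Ex Z <= Ex c.
Proof.
move=> FT Fm mZ Z0 c0 ci [W [[_ [Wp [Wn [cp cn hW]]]] Wc]].
have mp := condE_ge0_measurable Fm cp; have mn := condE_ge0_measurable Fm cn.
have [p0 _ ip] := cp; have [n0 _ in_] := cn.
have ip' : (\int[P]_w Wp w = \int[P]_w (Z w)%:E)%E.
  by rewrite ip//; apply: eq_integral => w _; rewrite max_l.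
have : (\int[P]_w `|Wn w| = 0)%E.
  under eq_integral do rewrite gee0_abs//.
  rewrite in_// integral0_eq// => w _.
  by rewrite max_r// oppr_le0.
move/(ae_eq_integral_abs _ measurableT mn) => Wn0.
apply: Rintegral_ge0_le => //; first by apply: Rintegral_ge0 => w _.
rewrite EFin_Rintegral// -ip'; apply: ae_ge0_le_integral => //.
- by move=> w _; rewrite lee_fin.
- exact/measurable_EFinP/measurable_EFinP/(measurable_int P).
move: hW Wc Wn0; apply: filterS3 => w [_ WE] Wcw /(_ Logic.I) n00 _.
by move: Wcw; rewrite WE n00 sube0.
Qed.

(** The bound is integrated in the form c + Wn <= Wp, all terms being nonnegative, so that no
    infinite values are subtracted; integrability of [Z] then allows the integral of [Wn] to be
    moved to the other side. *)
Lemma condE_ge_Rintegral F (Z c : T -> R) : F setT -> F `<=` measurable ->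
  int Z -> (forall w, 0 <= c w) -> int c ->
  condE_ge P F Z c -> Ex c <= Ex Z.
Proof.
move=> FT Fm Zi c0 ci [W [[_ [Wp [Wn [cp cn hW]]]] Wc]].
have mp := condE_ge0_measurable Fm cp; have mn := condE_ge0_measurable Fm cn.
have [p0 _ ip] := cp; have [n0 _ in_] := cn.
have mc : measurable_fun setT (EFin \o c) by exact: (measurable_int P).
have le : (\int[P]_w ((c w)%:E + Wn w) <= \int[P]_w Wp w)%E.
  apply: ae_ge0_le_integral => //.
  - by move=> w _; rewrite adde_ge0// lee_fin.
  - exact: emeasurable_funD.
  move: hW Wc; apply: filterS2 => w [h ->] cw _; move: h cw (n0 w) (p0 w).
  case: (Wp w) => [a| |]; case: (Wn w) => [b| |] //=.
  - by rewrite -!EFinD !lee_fin => _ ? _ _; lra.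
  - by move=> *; rewrite leey.
have ZpE : (\int[P]_w Wp w = \int[P]_w (fun w => (Z w)%:E)^\+ w)%E.
  by rewrite ip//; apply: eq_integral => w _; rewrite funeposE EFin_max.
have ZnE : (\int[P]_w Wn w = \int[P]_w (fun w => (Z w)%:E)^\- w)%E.
  by rewrite in_//; apply: eq_integral => w _; rewrite funenegE EFin_max.
rewrite -lee_fin !EFin_Rintegral// [leRHS]integralE -ZpE -ZnE.
rewrite leeBrDr; last first.
  by rewrite ZnE integrable_fin_num//; exact: integrable_funeneg.
by rewrite -ge0_integralD// => w _; rewrite lee_fin.
Qed.

(** Independence makes the law of (v, Phi) a product measure; by Fubini the inner integral, over the
    law of [Phi], is v times the mean of g, which is 0. *)
Lemma indep_Rintegral_mul0 d' (X : measurableType d') (F : set (set T))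
    (Phi : T -> X) (g : X -> R) (v : T -> R) :
  F `<=` measurable -> measurable_fun setT Phi -> indep_of P Phi F ->
  measurable_fun setT g -> (forall B, measurable B -> F (v @^-1` B)) ->
  int (fun w => g (Phi w)) -> Ex (fun w => g (Phi w)) = 0 ->
  int (fun w => g (Phi w) * v w) -> Ex (fun w => g (Phi w) * v w) = 0.
Proof.
move=> Fm mPhi ind mg vF gi g0 gvi.
have mv : measurable_fun setT v by move=> _ B mB; rewrite setTI; exact/Fm/vF.
pose VP w := (v w, Phi w).
have mVP : measurable_fun setT VP by exact/measurable_fun_pair.
pose mu1 : probability _ R := distribution P (mfun_Sub (mem_set mv) : {mfun T >-> R}).
pose mu2 : probability _ R := distribution P (mfun_Sub (mem_set mPhi) : {mfun T >-> X}).
pose mu : probability _ R := distribution P (mfun_Sub (mem_set mVP) : {mfun T >-> (R * X)%type}).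
have muE : forall S, measurable S -> (mu1 \x mu2)%E S = mu S.
  apply: product_measure_unique => A B mA mB.
  exact: ind (vF _ mA) mB.
pose k (z : (R * X)%type) : \bar R := (g z.2 * z.1)%:E.
have mk : measurable_fun setT k.
  apply/measurable_EFinP/measurable_funM; last exact: measurable_fst.
  by apply: measurableT_comp => //; exact: measurable_snd.
have ki : mu.-integrable setT k by apply: integrable_pushforward.
have ki' : (mu1 \x mu2)%E.-integrable setT k.
  apply/integrableP; split=> //.
  rewrite (eq_measure_integral mu) => [|S mS _]; last exact: muE.
  by case/integrableP : ki.
rewrite /Rintegral -(integral_distribution (X := mfun_Sub (mem_set mVP)) mk)//.
rewrite (eq_measure_integral (mu1 \x mu2)%E) => [|S mS _]; last exact/esym/muE.
rewrite -integral12_prod_meas1//.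
rewrite integral0_eq// => y _.
have mg' : measurable_fun setT (EFin \o g) by exact/measurable_EFinP.
have g2 : (\int[mu2]_z (g z)%:E = 0)%E.
  rewrite (integral_distribution (X := mfun_Sub (mem_set mPhi)) mg')//=.
  by rewrite -[LHS]EFin_Rintegral// g0.
have gi2 : mu2.-integrable setT (EFin \o g) by apply: integrable_pushforward.
rewrite /fubini_F; under eq_integral do rewrite /k /= mulrC EFinM.
by rewrite integralZl// g2 mule0.
Qed.

End probability.

(** * Gradients of convex functions with Lipschitz gradient *)

Section gradients.
Context (R : realType).
Implicit Types (p q : nat).

Lemma derive_grad p (g : 'cV[R]_p -> R) x v :
  differentiable g x -> 'D_v g x = dotv (grad g x) v.
Proof.
move=> dg; rewrite deriveE// dotvE.
rewrite {1}(matrix_sum_delta v) linear_sum/=; apply: eq_bigr => i _.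
by rewrite big_ord1 linearZ/= mxE deriveE// mulrC.
Qed.

(** The difference quotients along v of the composite and along M v of g coincide, so the chain rule
    for affine maps is an equality of limits of the same function. *)
Let quotient_comp_affine p q (g : 'cV[R]_p -> R) (M : 'M[R]_(p, q)) c x v :
  (fun h : R => h^-1 *: (((fun z => g (M *m z + c)) \o shift x) (h *: v)
     - g (M *m x + c))) =
  (fun h : R => h^-1 *: ((g \o shift (M *m x + c)) (h *: (M *m v))
     - g (M *m x + c))).
Proof. by apply/funext => h /=; rewrite mulmxDr -scalemxAr addrA. Qed.

Lemma derive_comp_affine p q (g : 'cV[R]_p -> R) (M : 'M[R]_(p, q)) c x v :
  'D_v (fun z => g (M *m z + c)) x = 'D_(M *m v) g (M *m x + c).
Proof. by rewrite /derive quotient_comp_affine. Qed.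

Lemma derivable_comp_affine p q (g : 'cV[R]_p -> R) (M : 'M[R]_(p, q)) c x v :
  derivable g (M *m x + c) (M *m v) ->
  derivable (fun z => g (M *m z + c)) x v.
Proof. by rewrite /derivable quotient_comp_affine. Qed.

(** For 0 < t <= 1 convexity bounds (g (x + t (y - x)) - g x) / t by g y - g x, the quadratic term
    being nonnegative there; then t tends to 0 from the right. *)
Lemma grad_ineq p (g : 'cV[R]_p -> R) mu x y :
  0 <= mu -> strongly_convex mu g -> differentiable g x ->
  g x + dotv (grad g x) (y - x) <= g y.
Proof.
move=> mu0 cg dg; rewrite -derive_grad// -lerBrDl.
have /cvg_dnbhs_at_right h : h^-1 *: ((g \o shift x) (h *: (y - x)) - g x) @[h --> 0^'] -->
    'D_(y - x) g x.
  exact: (diff_derivable (v := y - x) dg).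
rewrite -(cvg_lim _ h)//; apply: limr_le; first by apply/cvg_ex; eexists; exact: h.
near=> t.
have t0 : 0 < t by [].
have t1 : t <= 1 by near: t; exact: nbhs_right_le.
rewrite [leLHS](_ : _ = t^-1 * (g (t *: (y - x) + x) - g x))// ler_pdivrMl//.
have := cg y x t; rewrite (ltW t0) t1 => /(_ isT).
have -> : t *: y + (1 - t) *: x = t *: (y - x) + x.
  by apply/matrixP => i j; rewrite !mxE; ring.
have : 0 <= mu / 2 * t * (1 - t) * enorm (y - x) ^+ 2.
  by rewrite !mulr_ge0 ?enorm_ge0 ?subr_ge0 ?(ltW t0).
lra.
Unshelve. all: by end_near. Qed.

(** [L] has no assumed sign; its absolute value can safely multiply other inequalities. *)
Lemma lipschitz_gradW p (g : 'cV[R]_p -> R) L x y :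
  lipschitz_grad L g -> enorm (grad g x - grad g y) <= `|L| * enorm (x - y).
Proof.
by move=> gL; rewrite (le_trans (gL x y))// ler_wpM2r ?enorm_ge0 ?ler_norm.
Qed.

Lemma enorm_grad_le p (g : 'cV[R]_p -> R) L x :
  lipschitz_grad L g -> enorm (grad g x) <= enorm (grad g 0) + `|L| * enorm x.
Proof.
move=> gL; rewrite -[grad g x](subrK (grad g 0)) addrC.
rewrite (le_trans (ler_enormD _ _))// lerD2l.
by rewrite (le_trans (lipschitz_gradW _ _ gL))// subr0.
Qed.

(** The gradient inequality from 0 to x bounds g x below, and from x to 0 bounds it above. Quadratic
    growth is what makes the cost integrable. *)
Lemma normr_le_sqr_enorm p (g : 'cV[R]_p -> R) mu L x :
  0 <= mu -> strongly_convex mu g -> (forall x, differentiable g x) ->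
  lipschitz_grad L g ->
  `|g x| <= `|g 0| + enorm (grad g 0) ^+ 2 + (1 + `|L|) * enorm x ^+ 2.
Proof.
move=> mu0 cg dg gL.
have := grad_ineq x mu0 cg (dg 0); have := grad_ineq 0 mu0 cg (dg x).
rewrite subr0 sub0r dotvNr => hi lo.
have := normr_dotv_le (grad g 0) x; have := normr_dotv_le (grad g x) x.
rewrite !ler_norml => /andP[_ h1] /andP[h2 _].
have h3 := enorm_grad_le x gL.
have h4 : enorm (grad g x) * enorm x <=
    (enorm (grad g 0) + `|L| * enorm x) * enorm x.
  by rewrite ler_wpM2r ?enorm_ge0.
have := ler_norm (g 0); have := lerNnormlW (lexx `|g 0|) => n1 n2.
have := sqr_ge0 (enorm (grad g 0) - enorm x).
have := sqr_ge0 (enorm (grad g 0)); have := sqr_ge0 (enorm x).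
have : 0 <= `|L| * enorm x ^+ 2 by rewrite mulr_ge0 ?sqr_ge0.
move=> *; apply/andP; split; nra.
Qed.

End gradients.

(** * The cost as a function of the decision: gradient, quadratic bounds, growth *)

Section cost.
Context (R : realType) (m d : nat) (X : Type).
Variables (A : X -> 'M[R]_d) (b : X -> 'cV[R]_d).
Variables (C D : 'M[R]_(m, d)) (r : nat -> 'cV[R]_d).
Variables (gx : nat -> 'cV[R]_d -> R) (gy : nat -> 'cV[R]_m -> R).
Variables (n : nat) (mu L : R).
Hypotheses (mu0 : 0 <= mu).
Hypotheses (cx : strongly_convex mu (gx n)) (cy : strongly_convex mu (gy n)).
Hypotheses (dx : forall x, differentiable (gx n) x)
  (dy : forall y, differentiable (gy n) y).
Hypotheses (lx : lipschitz_grad L (gx n)) (ly : lipschitz_grad L (gy n)).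

Local Notation phi := (phi_map A b).
Local Notation out := (out_map C D r n).
Local Notation gradf := (grad_cost A b C D r gx gy n).

Lemma grad_costE v z :
  gradf v z = (A z)^T *m C^T *m grad (gy n) (out (phi v z))
    + (A z)^T *m grad (gx n) (phi v z).
Proof.
apply/colP => i; rewrite [LHS]mxE [RHS]mxE.
have e : (fun v' => cost A b C D r gx gy n v' z) =
    (fun v' => gx n (A z *m v' + b z)) \+
    (fun v' => gy n ((C *m A z) *m v' + (C *m b z + D *m r n))).
  by apply/funext => v'; rewrite /cost /phi_map /out_map /= mulmxDr mulmxA addrA.
rewrite e deriveD; last 2 first.
- exact/derivable_comp_affine/diff_derivable.
- exact/derivable_comp_affine/diff_derivable.
rewrite !derive_comp_affine !derive_grad// addrC.
have out_phi : C *m A z *m v + (C *m b z + D *m r n) = out (phi v z).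
  by rewrite /out_map /phi_map mulmxDr mulmxA addrA.
rewrite out_phi -[A z *m v + b z]/(phi v z).
have row_dot q (M : 'M[R]_(q, d)) (w : 'cV[R]_q) :
    dotv w (M *m delta_mx i 0) = (M^T *m w) i 0.
  rewrite dotv_mulmx dotvE (bigD1 i)//= big1 => [|j ji].
    by rewrite !mxE !eqxx mulr1 addr0.
  by rewrite !mxE (negbTE ji) mulr0.
by rewrite !row_dot trmx_mul.
Qed.

Lemma cost_ge v v' z :
  cost A b C D r gx gy n v z + dotv (gradf v z) (v' - v) <=
  cost A b C D r gx gy n v' z.
Proof.
have := grad_ineq (phi v' z) mu0 cx (dx (phi v z)).
have := grad_ineq (out (phi v' z)) mu0 cy (dy (out (phi v z))).
have -> : out (phi v' z) - out (phi v z) = C *m A z *m (v' - v).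
  rewrite /out_map /phi_map !mulmxDr mulmxN !mulmxA.
  by apply/matrixP => i j; rewrite !mxE; ring.
have -> : phi v' z - phi v z = A z *m (v' - v).
  by rewrite /phi_map mulmxBr; apply/matrixP => i j; rewrite !mxE; ring.
rewrite !dotv_mulmx trmx_mul /cost grad_costE dotvDl; lra.
Qed.

Lemma grad_cost_lipschitz v v' z :
  enorm (gradf v' z - gradf v z) <=
  opnorm (A z) ^+ 2 * (`|L| * (1 + opnorm C ^+ 2)) * enorm (v' - v).
Proof.
rewrite !grad_costE.
have -> (a a' : 'cV[R]_m) (e e' : 'cV[R]_d) :
    (A z)^T *m C^T *m a' + (A z)^T *m e' - ((A z)^T *m C^T *m a + (A z)^T *m e) =
    (A z)^T *m (C^T *m (a' - a)) + (A z)^T *m (e' - e).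
  rewrite !mulmxBr !mulmxA.
  by apply/matrixP => i j; rewrite !mxE; ring.
have dphi : enorm (phi v' z - phi v z) <= opnorm (A z) * enorm (v' - v).
  have -> : phi v' z - phi v z = A z *m (v' - v).
    by rewrite /phi_map mulmxBr; apply/matrixP => i j; rewrite !mxE; ring.
  exact: enorm_mulmx.
have dout : enorm (out (phi v' z) - out (phi v z)) <=
    opnorm C * enorm (phi v' z - phi v z).
  have -> : out (phi v' z) - out (phi v z) = C *m (phi v' z - phi v z).
    by rewrite /out_map mulmxBr; apply/matrixP => i j; rewrite !mxE; ring.
  exact: enorm_mulmx.
set a := opnorm (A z) in dphi *; set c := opnorm C in dout *.
have a0 : 0 <= a by exact: opnorm_ge0.
have c0 : 0 <= c by exact: opnorm_ge0.
have ac0 : 0 <= a * c by exact: mulr_ge0.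
rewrite (le_trans (ler_enormD _ _))//.
have h1 : enorm ((A z)^T *m (C^T *m
      (grad (gy n) (out (phi v' z)) - grad (gy n) (out (phi v z))))) <=
    a * (c * (`|L| * (c * (a * enorm (v' - v))))).
  rewrite (le_trans (enorm_trmx_mulmx _ _))// ler_wpM2l//.
  rewrite (le_trans (enorm_trmx_mulmx _ _))// ler_wpM2l//.
  rewrite (le_trans (lipschitz_gradW _ _ ly))// ler_wpM2l//.
  by rewrite (le_trans dout)// ler_wpM2l.
have h2 : enorm ((A z)^T *m (grad (gx n) (phi v' z) - grad (gx n) (phi v z))) <=
    a * (`|L| * (a * enorm (v' - v))).
  rewrite (le_trans (enorm_trmx_mulmx _ _))// ler_wpM2l//.
  by rewrite (le_trans (lipschitz_gradW _ _ lx))// ler_wpM2l.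
rewrite (le_trans (lerD h1 h2))//.
lra.
Qed.

(** [cost_ge] based at v', with its gradient moved to v by the Lipschitz bound. The curvature
    constant is twice that of the integral form, which is harmless: in [variational_inequality] this
    term comes with a factor t^2. *)
Lemma cost_le v v' z :
  cost A b C D r gx gy n v' z <=
  cost A b C D r gx gy n v z + dotv (gradf v z) (v' - v)
  + opnorm (A z) ^+ 2 * (`|L| * (1 + opnorm C ^+ 2)) * enorm (v' - v) ^+ 2.
Proof.
have := cost_ge v' v z; have := dotv_le (gradf v' z - gradf v z) (v' - v).
have := ler_wpM2r (enorm_ge0 (v' - v)) (grad_cost_lipschitz v v' z).
rewrite -(opprB v') dotvNr [dotv (_ - _) _]dotvDl dotvNl; lra.
Qed.

(** Growth is quadratic in A and b, but squares are bounded through 2 s^2 <= 1 + s^4, because the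
    moments at hand are the fourth ones. *)
Lemma normr_cost_le v : exists k : R, 0 <= k /\ forall z,
  `|cost A b C D r gx gy n v z| <=
  k * (1 + opnorm (A z) ^+ 4 + enorm (b z) ^+ 4).
Proof.
pose c := opnorm C; pose e := enorm (D *m r n); pose w := enorm v.
pose kx := `|gx n 0| + enorm (grad (gx n) 0) ^+ 2.
pose ky := `|gy n 0| + enorm (grad (gy n) 0) ^+ 2.
pose l := 1 + `|L|.
have c0 : 0 <= c by exact: opnorm_ge0.
have e0 : 0 <= e by exact: enorm_ge0.
have w0 : 0 <= w by exact: enorm_ge0.
have kx0 : 0 <= kx by rewrite addr_ge0 ?sqr_ge0.
have ky0 : 0 <= ky by rewrite addr_ge0 ?sqr_ge0.
have l0 : 0 <= l by rewrite addr_ge0.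
exists (kx + ky + l * (1 + 2 * c ^+ 2) * (4 * w ^+ 2 + 4) + l * (2 * e ^+ 2)).
split.
  by do ?[done|exact: sqr_ge0|apply: addr_ge0|apply: mulr_ge0].
move=> z; set a := opnorm (A z); set t := enorm (b z).
have a0 : 0 <= a by exact: opnorm_ge0.
have t0 : 0 <= t by exact: enorm_ge0.
rewrite /cost (le_trans (ler_normD _ _))//.
have hx := normr_le_sqr_enorm (phi v z) mu0 cx dx lx.
have hy := normr_le_sqr_enorm (out (phi v z)) mu0 cy dy ly.
rewrite -/kx -/l in hx; rewrite -/ky -/l in hy.
set X2 := enorm (phi v z) ^+ 2 in hx.
set Y2 := enorm (out (phi v z)) ^+ 2 in hy.
pose M := 1 + a ^+ 4 + t ^+ 4.
have a4 : 0 <= a ^+ 4 by exact: exprn_ge0.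
have t4 : 0 <= t ^+ 4 by exact: exprn_ge0.
have M1 : 1 <= M by rewrite /M; lra.
have sqr_le (p q s : R) : 0 <= p -> p <= q + s -> p ^+ 2 <= 2 * q ^+ 2 + 2 * s ^+ 2.
  move=> p0 pqs; have : p ^+ 2 <= (q + s) ^+ 2.
    by rewrite ler_pXn2r ?nnegrE// (le_trans p0).
  by have := sqr_ge0 (q - s); lra.
have hX : X2 <= (4 * w ^+ 2 + 4) * M.
  have : X2 <= 2 * (a * w) ^+ 2 + 2 * t ^+ 2.
    apply: sqr_le; first exact: enorm_ge0.
    by rewrite (le_trans (ler_enormD _ _))// lerD2r enorm_mulmx.
  have : a ^+ 2 <= M by rewrite /M; have := sqr_ge0 (a ^+ 2 - 1); lra.
  have : t ^+ 2 <= M by rewrite /M; have := sqr_ge0 (t ^+ 2 - 1); lra.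
  by have := sqr_ge0 w; nra.
have hY : Y2 <= 2 * c ^+ 2 * X2 + 2 * e ^+ 2.
  have : Y2 <= 2 * (c * enorm (phi v z)) ^+ 2 + 2 * e ^+ 2.
    apply: sqr_le; first exact: enorm_ge0.
    by rewrite (le_trans (ler_enormD _ _))// lerD2r enorm_mulmx.
  by rewrite exprMn mulrA.
rewrite -/M (le_trans (lerD hx hy))//.
have h1 : l * Y2 <= l * (2 * c ^+ 2 * X2 + 2 * e ^+ 2) by rewrite ler_wpM2l.
have h2 : l * (1 + 2 * c ^+ 2) * X2 <= l * (1 + 2 * c ^+ 2) * ((4 * w ^+ 2 + 4) * M).
  by rewrite ler_wpM2l//; do ?[done|exact: sqr_ge0|apply: addr_ge0|apply: mulr_ge0].
have h3 : kx + ky + l * (2 * e ^+ 2) <= (kx + ky + l * (2 * e ^+ 2)) * M.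
  by rewrite ler_peMr//; do ?[done|exact: sqr_ge0|apply: addr_ge0|apply: mulr_ge0].
lra.
Qed.

End cost.

(** * The scalar recursion and its limit superior *)

Section recursion.
Context (R : realType).

Lemma limn_esup_le (u : (\bar R)^nat) (l : R) :
  (forall e, 0 < e -> exists N, forall n, (N <= n)%N -> (u n <= (l + e)%:E)%E) ->
  (limn_esup u <= l%:E)%E.
Proof.
move=> h; apply/lee_addgt0Pr => e /h[N hN].
apply: (@le_trans _ _ (ereal_sup (u @` [set n | (N <= n)%N]))).
  by apply: ereal_inf_lbound; exists [set n | (N <= n)%N] => //; exists N.
by apply: ge_ereal_sup => _ [n /hN hn <-]; rewrite -EFinD.
Qed.

Lemma sqrtr_le (x y : R) : 0 <= y -> x <= y ^+ 2 -> Num.sqrt x <= y.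
Proof. by move=> y0 h; rewrite -(ger0_norm y0) -sqrtr_sqr ler_wsqrtr. Qed.

(* The map t |-> sqrt ((1 - a) t^2 + a V) + c sends [0, s] to itself and
   contracts the excess over s by the factor sqrt (1 - a), where
   s = sqrt V + 2 c / a. *)
Lemma sqrt_affine_contraction (a V c t x : R) :
  0 < a <= 1 -> 0 <= V -> 0 <= c -> 0 <= t -> 0 <= x ->
  let s := Num.sqrt V + 2 * c / a in
  x <= s + t ->
  Num.sqrt ((1 - a) * x ^+ 2 + a * V) + c <= s + Num.sqrt (1 - a) * t.
Proof.
move=> /andP[a0 a1] V0 c0 t0 x0 s xst.
pose v := Num.sqrt V; pose g := 2 * c / a.
have sE : s = v + g by [].
have v0 : 0 <= v by exact: sqrtr_ge0.
have vV : v ^+ 2 = V by rewrite sqr_sqrtr.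
have ag : a * g = 2 * c by rewrite /g mulrC divfK ?gt_eqF.
have g0 : 0 <= g by rewrite divr_ge0 ?mulr_ge0 ?(ltW a0).
set p := Num.sqrt (1 - a).
have p0 : 0 <= p by exact: sqrtr_ge0.
have pE : p ^+ 2 = 1 - a by rewrite sqr_sqrtr// subr_ge0.
have s0 : 0 <= s by rewrite sE addr_ge0.
have gc : 2 * c <= g by rewrite -ag ler_piMl.
have sc : 0 <= s - c by rewrite sE; lra.
(* [s] only overestimates the fixed point: since a g = 2 c, the right side exceeds the left one by 2
   v c + c^2. *)
have sV : (1 - a) * s ^+ 2 + a * V <= (s - c) ^+ 2.
  have : (s - c) ^+ 2 - (1 - a) * s ^+ 2 - a * V =
      2 * v * (a * g) - 2 * v * c + (a * g) * g - 2 * c * g + c ^+ 2.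
    by rewrite sE -vV; ring.
  rewrite ag; have := mulr_ge0 v0 c0; have := sqr_ge0 c; lra.
(* Needed for the cross term: 2 (s - c) p t must dominate 2 p^2 s t = 2 (1 - a) s t. *)
have ps : p * s <= s - c.
  rewrite -(@ler_pXn2r _ 2) ?nnegrE ?mulr_ge0// exprMn pE.
  by have := mulr_ge0 (ltW a0) V0; lra.
have h : (1 - a) * x ^+ 2 + a * V <= (s - c + p * t) ^+ 2.
  have : (1 - a) * x ^+ 2 <= (1 - a) * (s + t) ^+ 2.
    by rewrite ler_wpM2l ?subr_ge0// ler_pXn2r ?nnegrE ?addr_ge0.
  have : p * (p * s) * t <= p * (s - c) * t by rewrite ler_wpM2r ?ler_wpM2l.
  rewrite mulrA -expr2 pE; rewrite [(s - c + _) ^+ 2]sqrrD exprMn pE; lra.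
have : Num.sqrt ((1 - a) * x ^+ 2 + a * V) <= s - c + p * t.
  by rewrite sqrtr_le// addr_ge0// mulr_ge0.
lra.
Qed.

(** Iterating the contraction gives sqrt (E (N + k)) <= s + p^k K. The extended real sequence [u] is
    tied to [E] from N on only, since earlier terms may be infinite. *)
Lemma recursion_limn_esup (E : nat -> R) (u : (\bar R)^nat) (a V c M : R) N :
  0 < a <= 1 -> 0 <= V -> 0 <= c ->
  (forall n, (N <= n)%N -> u n = (E n)%:E) ->
  (forall n, (N <= n)%N -> 0 <= E n) ->
  E N <= M ->
  (forall n, (N <= n)%N ->
     E n.+1 <= (Num.sqrt ((1 - a) * E n + a * V) + c) ^+ 2) ->
  (limn_esup u <= ((Num.sqrt V + 2 * c / a) ^+ 2)%:E)%E.
Proof.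
move=> a01 V0 c0 uE E0 EM EN; have [a0 a1] := andP a01.
set s := Num.sqrt V + _; set p := Num.sqrt (1 - a).
pose K := Num.sqrt (E N).
have K0 : 0 <= K by exact: sqrtr_ge0.
have p0 : 0 <= p by exact: sqrtr_ge0.
have s0 : 0 <= s.
  by rewrite addr_ge0 ?sqrtr_ge0// divr_ge0 ?mulr_ge0 ?(ltW a0).
have p1 : p < 1 by rewrite -sqrtr1 ltr_sqrt// ltrBlDr ltrDl.
have eK k : Num.sqrt (E (N + k)%N) <= s + p ^+ k * K.
  elim: k => [|k ih]; first by rewrite addn0 expr0 mul1r lerDr.
  have Nk : (N <= N + k)%N by exact: leq_addr.
  rewrite addnS exprS -mulrA.
  apply: le_trans (sqrt_affine_contraction a01 V0 c0 _ (sqrtr_ge0 _) ih); last first.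
    by rewrite mulr_ge0// exprn_ge0.
  rewrite sqr_sqrtr ?E0//.
  by rewrite sqrtr_le ?EN// addr_ge0// sqrtr_ge0.
apply: limn_esup_le => e e0.
(* With q = p^k <= 1 one has (s + q K)^2 <= s^2 + (2 s K + K^2) q. *)
have L0 : 0 <= 2 * s * K + K ^+ 2 by rewrite addr_ge0 ?sqr_ge0// !mulr_ge0.
have : (2 * s * K + K ^+ 2) * p ^+ k @[k --> \oo] --> 0.
  by apply: cvg_geometric; rewrite ger0_norm.
move=> /cvgrPdist_le /(_ e e0) [k0 _ hk0].
exists (N + k0)%N => n nN.
have Nn : (N <= n)%N by exact: leq_trans (leq_addr _ _) nN.
rewrite uE// lee_fin.
have kk0 : (k0 <= n - N)%N by rewrite leq_subRL.
have := hk0 _ kk0; rewrite sub0r normrN /= => h.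
have := eK (n - N)%N; rewrite subnKC// => en.
set q := p ^+ (n - N) in h en.
have q0 : 0 <= q by exact: exprn_ge0.
have q1 : q <= 1 by rewrite exprn_ile1// ltW.
have qq : q ^+ 2 <= q by rewrite expr2 ler_piMl.
have {}en : E n <= (s + q * K) ^+ 2.
  rewrite -[leLHS]sqr_sqrtr ?E0// ler_pXn2r ?nnegrE ?sqrtr_ge0//.
  by rewrite addr_ge0// mulr_ge0.
have {}h := le_trans (ler_norm _) h.
rewrite (le_trans en)//.
have : K ^+ 2 * q ^+ 2 <= K ^+ 2 * q by rewrite ler_wpM2l ?sqr_ge0.
by rewrite sqrrD exprMn; lra.
Qed.

Lemma eps_sum_ge (b alpha muf sigmaf epsm : R) :
  0 < muf -> 0 < alpha -> 0 <= b -> 0 <= epsm -> 0 <= sigmaf ->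
  muf^-1 * b * epsm <=
    alpha * eps_a b muf sigmaf + eps_b b alpha muf epsm.
Proof.
move=> m0 a0 b0 e0 s0; rewrite /eps_a /eps_b.
have k0 : 0 <= muf^-1 * b by rewrite mulr_ge0// invr_ge0 ltW.
set k := muf^-1 * b in k0 *.
have h1 : 0 <= alpha * (k * (2 * sigmaf ^+ 2 + sigmaf)).
  by do ?[done|exact: sqr_ge0|exact: ltW|apply: addr_ge0|apply: mulr_ge0].
have h2 : 0 <= k * (alpha * (2 * epsm ^+ 2 + epsm)).
  by do ?[done|exact: sqr_ge0|exact: ltW|apply: addr_ge0|apply: mulr_ge0].
lra.
Qed.

(** With a = alpha muf, v = sqrt V and g = gammab, the tracking bound is V + g^2 / a + 4 g^2 / a^2 +
    4 g v / (a sqrt a), while the square is V + 4 g v / a + 4 g^2 / a^2; it remains to use sqrt a <=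
    1. *)
Lemma tracking_bound_ge (b alpha muf sigmaf epsm gammab : R) :
  0 < muf -> 0 < alpha -> alpha * muf <= 1 -> 0 <= gammab ->
  let V := alpha * eps_a b muf sigmaf + eps_b b alpha muf epsm in
  0 <= V ->
  (Num.sqrt V + 2 * gammab / (alpha * muf)) ^+ 2 <=
  tracking_bound b alpha muf sigmaf epsm gammab.
Proof.
move=> m0 a0 am1 g0 V V0; rewrite /tracking_bound -/V.
set a := alpha * muf; have A0 : 0 < a by exact: mulr_gt0.
have a_neq0 : a != 0 by rewrite gt_eqF.
have m_neq0 : muf != 0 by rewrite gt_eqF.
have al_neq0 : alpha != 0 by rewrite gt_eqF.
pose v := Num.sqrt V.
have v0 : 0 <= v by exact: sqrtr_ge0.
have vV : v ^+ 2 = V by rewrite sqr_sqrtr.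
have t2 : alpha^-1 * (eps_c muf gammab + b_one muf * (eps_c muf gammab / alpha)) =
    gammab ^+ 2 / a + 4 * gammab ^+ 2 / a ^+ 2.
  by rewrite /eps_c /b_one /a; field; rewrite al_neq0 m_neq0.
have pw : alpha `^ (3 / 2) = alpha * Num.sqrt alpha.
  have -> : 3 / 2 = 1 + 2^-1 :> R by field.
  by rewrite powRD ?(gt_eqF a0) ?implybT// powRr1 ?(ltW a0)// powR12_sqrt ?(ltW a0).
have t3 : b_one muf / alpha `^ (3 / 2) * Num.sqrt (eps_c muf gammab * V) =
    4 * gammab * v / (a * Num.sqrt a).
  rewrite pw /eps_c /b_one sqrtrM; last by rewrite mulr_ge0 ?sqr_ge0// invr_ge0 ltW.
  rewrite sqrtrM ?invr_ge0 ?(ltW m0)// sqrtr_sqr ger0_norm// -/v.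
  rewrite sqrtrV ?(ltW m0)// /a sqrtrM ?(ltW a0)//.
  have sm : Num.sqrt muf != 0 by rewrite gt_eqF// sqrtr_gt0.
  have sa : Num.sqrt alpha != 0 by rewrite gt_eqF// sqrtr_gt0.
  by field; rewrite sm sa al_neq0 m_neq0.
rewrite t2 t3.
have sa0 : 0 < Num.sqrt a by rewrite sqrtr_gt0.
have sa1 : Num.sqrt a <= 1 by rewrite -sqrtr1 ler_sqrt.
have h3 : 4 * gammab * v / a <= 4 * gammab * v / (a * Num.sqrt a).
  have -> : 4 * gammab * v / (a * Num.sqrt a) = 4 * gammab * v / a / Num.sqrt a.
    by rewrite invfM !mulrA.
  rewrite ler_peMr//; last by rewrite invf_ge1.
  by rewrite divr_ge0 ?(ltW A0)// !mulr_ge0.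
have h2 : 0 <= gammab ^+ 2 / a by rewrite divr_ge0 ?sqr_ge0 ?ltW.
rewrite sqrrD -/v vV.
have -> : v * (2 * gammab / a) *+ 2 = 4 * gammab * v / a by field.
have -> : (2 * gammab / a) ^+ 2 = 4 * gammab ^+ 2 / a ^+ 2 by field.
lra.
Qed.

End recursion.

(** * First-order optimality in the mean and one step in mean square *)

Section stochastic_step.
Context d (T : measurableType d) (R : realType) (P : probability T R).

Local Notation int f := (P.-integrable setT (EFin \o f%R)).
Local Notation Ex f := (Rintegral P setT f%R).

(** Integrating the upper bound and using minimality gives 0 <= t E g + t^2 E K; divide by t and let
    t tend to 0. The two-sided bound also makes [f t] integrable. *)
Lemma variational_inequality (f0 : T -> R) (f : R -> T -> R) (g K : T -> R) :
  int f0 -> int g -> int K ->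
  (forall t, 0 < t -> t < 1 -> measurable_fun setT (f t)) ->
  (forall t w, 0 < t -> t < 1 ->
     f0 w + t * g w <= f t w <= f0 w + t * g w + t ^+ 2 * K w) ->
  (forall t, 0 < t -> t < 1 ->
     (\int[P]_w (f0 w)%:E <= \int[P]_w (f t w)%:E)%E) ->
  0 <= Ex g.
Proof.
move=> i0 ig iK mf fb fmin.
have key t : 0 < t -> t < 1 -> - Ex g <= t * Ex K.
  move=> t0 t1.
  have i1 : int (fun w => f0 w + t * g w).
    by apply: integrable_add => //; exact: integrable_scale.
  have i2 : int (fun w => t ^+ 2 * K w) by exact: integrable_scale.
  have ift : int (f t).
    have ib : int (fun w => `|f0 w + t * g w| + `|t ^+ 2 * K w|).
      by apply: integrable_add; exact: integrable_norm.
    apply: integrable_le ib => [|w]; first exact: mf.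
    have /andP[lo hi] := fb t w t0 t1.
    have := ler_norm (f0 w + t * g w); have := ler_norm (t ^+ 2 * K w).
    have := lerNnormlW (lexx `|f0 w + t * g w|).
    have := normr_ge0 (t ^+ 2 * K w).
    by move=> *; rewrite ler_norml; apply/andP; split; lra.
  have : Ex f0 <= Ex (f t) by rewrite -lee_fin !EFin_Rintegral// fmin.
  have : Ex (f t) <= Ex (fun w => f0 w + t * g w + t ^+ 2 * K w).
    apply: Rintegral_le => // [|w]; first exact: integrable_add.
    by have /andP[] := fb t w t0 t1.
  rewrite RintegralD// RintegralD//; last exact: integrable_scale.
  rewrite !RintegralZl// => h1 h2.
  by rewrite -(ler_pM2l t0); lra.
rewrite leNgt; apply/negP => g0.
have [K0|K0] := leP (Ex K) 0.
  have := key 2^-1; rewrite invr_gt0 ltr0n invf_lt1// ltr1n => /(_ isT isT); lra.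
set k := Ex K in key K0; set e := Ex g in key g0.
(* Chosen so that t < 1/2 and t k < - e, against [key]. *)
pose t := - e / (k - e) / 2.
have ke : 0 < k - e by lra.
have tE : 2 * t * (k - e) = - e by rewrite /t; field; rewrite gt_eqF.
have t0 : 0 < t by rewrite /t divr_gt0// divr_gt0// oppr_gt0.
have t1 : t < 1 by nra.
have := key _ t0 t1; nra.
Qed.

Definition square_integrable p (Z : T -> 'cV[R]_p) : Prop :=
  mx_measurable measurable Z /\ int (fun w => enorm (Z w) ^+ 2).

Lemma square_integrable_dotv p (Y Z : T -> 'cV[R]_p) :
  square_integrable Y -> square_integrable Z ->
  int (fun w => dotv (Y w) (Z w)).
Proof.
move=> [mY iY] [mZ iZ]; apply: integrable_le (integrable_add iY iZ) => [|w].
  exact: measurable_dotv.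
rewrite (le_trans (normr_dotv_le _ _))//.
have := sqr_ge0 (enorm (Y w) - enorm (Z w)).
by have := sqr_ge0 (enorm (Y w)); have := sqr_ge0 (enorm (Z w)); lra.
Qed.

Lemma square_integrableD p (Y Z : T -> 'cV[R]_p) :
  square_integrable Y -> square_integrable Z ->
  square_integrable (fun w => Y w + Z w).
Proof.
move=> sY sZ; have [mY iY] := sY; have [mZ iZ] := sZ.
have mYZ := mx_measurableD mY mZ; split=> //.
have := integrable_add (integrable_add iY iZ)
  (integrable_scale 2 (square_integrable_dotv sY sZ)).
apply: integrable_le => [|w].
  by apply: measurable_funX; exact: measurable_enorm.
rewrite ger0_norm ?sqr_ge0// !sqr_enorm !dotv_linE (dotvC (Z w)); lra.
Qed.

Lemma square_integrable_bounded p (Z : T -> 'cV[R]_p) B :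
  mx_measurable measurable Z -> (forall w, enorm (Z w) <= B) ->
  square_integrable Z.
Proof.
move=> mZ ZB; split=> //; apply: integrable_le (integrable_cst P (B ^+ 2)) => [|w].
  by apply: measurable_funX; exact: measurable_enorm.
rewrite ger0_norm ?sqr_ge0// ler_pXn2r ?nnegrE ?enorm_ge0//.
by rewrite (le_trans _ (ZB w)) ?enorm_ge0.
Qed.

(* The cross terms are controlled by Cauchy-Schwarz, except 2 <Delta, Xi>,
   which is absorbed into |Delta|^2 + |Xi|^2 so that the noise level and the
   perturbation level do not multiply. *)
Lemma gradient_step_mse p (ut gt Delta Xi v : T -> 'cV[R]_p)
    (alpha muf Lf sigma xi B : R) :
  0 < alpha -> 0 <= Lf -> 0 <= sigma -> 0 <= xi -> 0 <= B ->
  alpha * Lf ^+ 2 <= muf ->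
  mx_measurable measurable ut -> (forall w, enorm (ut w) <= B) ->
  square_integrable gt -> square_integrable Delta -> square_integrable Xi ->
  mx_measurable measurable v ->
  Ex (fun w => enorm (gt w) ^+ 2) <= Lf ^+ 2 * Ex (fun w => enorm (ut w) ^+ 2) ->
  muf * Ex (fun w => enorm (ut w) ^+ 2) <= Ex (fun w => dotv (gt w) (ut w)) ->
  Ex (fun w => enorm (Delta w) ^+ 2) <= sigma ^+ 2 ->
  Ex (fun w => dotv (Delta w) (ut w)) = 0 ->
  Ex (fun w => enorm (Xi w) ^+ 2) <= xi ^+ 2 ->
  (forall w, enorm (v w) ^+ 2 <=
     enorm (ut w - alpha *: (gt w + Delta w + Xi w)) ^+ 2) ->
  Ex (fun w => enorm (v w) ^+ 2) <=
    (1 - alpha * muf) * Ex (fun w => enorm (ut w) ^+ 2)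
    + (alpha ^+ 2 * (2 * sigma ^+ 2 + 2 * xi ^+ 2
                     + 2 * Lf * B * sigma + 2 * Lf * B * xi)
       + 2 * alpha * B * xi).
Proof.
move=> a0 L0 s0 xi0 B0 aL mut utB sg sD sX mv gL gmu Ds D0 Xx vle.
have sut := square_integrable_bounded mut utB.
have [mg ig] := sg; have [mD iD] := sD; have [mX iX] := sX; have [_ iut] := sut.
have utB2 : Ex (fun w => enorm (ut w) ^+ 2) <= B ^+ 2.
  rewrite -[leRHS](Rintegral_prob_cst P); apply: Rintegral_le => // [|w].
    exact: integrable_cst.
  by rewrite ler_pXn2r ?nnegrE ?enorm_ge0.
have gLB : Ex (fun w => enorm (gt w) ^+ 2) <= (Lf * B) ^+ 2.
  by rewrite (le_trans gL)// exprMn ler_wpM2l ?sqr_ge0.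
have LB0 : 0 <= Lf * B by exact: mulr_ge0.
have [igD cgD] := Rintegral_cauchy_schwarz (measurable_enorm mg)
  (measurable_enorm mD) LB0 s0 ig iD gLB Ds.
have [igX cgX] := Rintegral_cauchy_schwarz (measurable_enorm mg)
  (measurable_enorm mX) LB0 xi0 ig iX gLB Xx.
have [iuX cuX] := Rintegral_cauchy_schwarz (measurable_enorm mut)
  (measurable_enorm mX) B0 xi0 iut iX utB2 Xx.
have igu := square_integrable_dotv sg sut.
have iDu := square_integrable_dotv sD sut.
(* The inner products of [ut] with [gt] and [Delta] are kept exact, because only their means are
   controlled; the other cross terms become products of norms, except the one absorbed into
   squares. *)
pose bnd w := enorm (ut w) ^+ 2 + (- 2 * alpha) * dotv (gt w) (ut w)
  + (- 2 * alpha) * dotv (Delta w) (ut w) + alpha ^+ 2 * enorm (gt w) ^+ 2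
  + (2 * alpha ^+ 2) * enorm (Delta w) ^+ 2 + (2 * alpha ^+ 2) * enorm (Xi w) ^+ 2
  + (2 * alpha ^+ 2) * (`|enorm (gt w)| * `|enorm (Delta w)|)
  + (2 * alpha ^+ 2) * (`|enorm (gt w)| * `|enorm (Xi w)|)
  + (2 * alpha) * (`|enorm (ut w)| * `|enorm (Xi w)|).
have vb w : enorm (v w) ^+ 2 <= bnd w.
  rewrite (le_trans (vle w))// /bnd !(ger0_norm (enorm_ge0 _)).
  rewrite sqr_enormB dotvZr enormZ exprMn real_normK ?num_real//.
  rewrite (sqr_enorm (gt w + Delta w + Xi w)) !dotv_linE -!sqr_enorm.
  rewrite !(dotvC (ut w)) !(dotvC (Xi w) (gt w)) !(dotvC (Xi w) (Delta w)).
  rewrite (dotvC (Delta w) (gt w)).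
  have a20 : 0 <= alpha ^+ 2 by exact: sqr_ge0.
  have h1 := ler_wpM2l a20 (dotv_le (gt w) (Delta w)).
  have h2 := ler_wpM2l a20 (dotv_le (gt w) (Xi w)).
  have h3 := ler_wpM2l (ltW a0) (normr_dotv_le (Xi w) (ut w)).
  have h4 := ler_wpM2l a20 (sqr_ge0 (enorm (Delta w) - enorm (Xi w))).
  have h5 := ler_wpM2l a20 (dotv_le (Delta w) (Xi w)).
  have h6 := ler_wpM2l (ltW a0) (lerNnormlW (lexx `|dotv (Xi w) (ut w)|)).
  lra.
have iS (k : R) (h : T -> R) : int h -> int (fun w => k * h w) by exact: integrable_scale.
have iA (h h' : T -> R) : int h -> int h' -> int (fun w => h w + h' w).
  exact: integrable_add.
have ib : int bnd by rewrite /bnd; repeat first [assumption | apply: (iA) | apply: (iS)].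
have iv : int (fun w => enorm (v w) ^+ 2).
  apply: integrable_le ib => [|w]; last by rewrite ger0_norm ?sqr_ge0.
  by apply: measurable_funX; exact: measurable_enorm.
apply: (le_trans (Rintegral_le iv ib vb)); rewrite /bnd.
do 8 (rewrite RintegralD//;
  try solve [repeat first [assumption | apply: (iA) | apply: (iS)]]).
rewrite !RintegralZl// D0.
set e := Ex (fun w => enorm (ut w) ^+ 2) in utB2 gL gmu *.
have e0 : 0 <= e by apply: Rintegral_ge0 => w _; exact: sqr_ge0.
have a20 : 0 <= alpha ^+ 2 by exact: sqr_ge0.
have h1 := ler_wpM2l a20 gL.
have h2 := ler_wpM2l (ltW a0) gmu.
(* The step-size condition turns the factor 1 - 2 alpha muf + alpha^2 Lf^2 into 1 - alpha muf. *)
have h3 : alpha * (alpha * Lf ^+ 2) * e <= alpha * muf * e.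
  by rewrite ler_wpM2r// ler_wpM2l// ltW.
have h4 := ler_wpM2l a20 Ds.
have h5 := ler_wpM2l a20 Xx.
have h6 := ler_wpM2l a20 cgD.
have h7 := ler_wpM2l a20 cgX.
have h8 := ler_wpM2l (ltW a0) cuX.
lra.
Qed.

(** Minkowski's inequality for a deterministic shift: the cross term is 2 c E |v|, at most 2 c times
    the root mean square. *)
Lemma drift_mse p (v : T -> 'cV[R]_p) (delta : 'cV[R]_p) (c : R) :
  square_integrable v -> enorm delta <= c ->
  Ex (fun w => enorm (v w + delta) ^+ 2) <=
    (Num.sqrt (Ex (fun w => enorm (v w) ^+ 2)) + c) ^+ 2.
Proof.
move=> sv dc; have [mv iv] := sv.
have c0 : 0 <= c by rewrite (le_trans _ dc) ?enorm_ge0.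
have [iv1 hv1] := Rintegral_sqr_ge iv (measurable_enorm mv) (fun w => enorm_ge0 _).
set s := Num.sqrt _ in hv1 *.
have e0 : 0 <= Ex (fun w => enorm (v w) ^+ 2).
  by apply: Rintegral_ge0 => w _; exact: sqr_ge0.
have ib : int (fun w => enorm (v w) ^+ 2 + (2 * c) * enorm (v w) + c ^+ 2).
  apply: integrable_add; last exact: integrable_cst.
  by apply: integrable_add => //; exact: integrable_scale.
have [_ ivd] := square_integrableD sv
  (square_integrable_bounded (@mx_measurable_cst _ _ _ _ _ delta) (fun=> dc)).
apply: (le_trans (Rintegral_le ivd ib _)) => [w|].
  have : enorm (v w + delta) ^+ 2 <= (enorm (v w) + c) ^+ 2.
    rewrite ler_pXn2r ?nnegrE ?addr_ge0 ?enorm_ge0//.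
    by rewrite (le_trans (ler_enormD _ _))// lerD2l.
  by rewrite sqrrD; lra.
have i2 : int (fun w => 2 * c * enorm (v w)) by exact: integrable_scale.
rewrite RintegralD//; [|exact: integrable_add|exact: integrable_cst].
rewrite RintegralD// RintegralZl// Rintegral_prob_cst.
have sE : s ^+ 2 = Ex (fun w => enorm (v w) ^+ 2) by rewrite sqr_sqrtr.
rewrite -sE sqrrD.
by have := ler_wpM2l c0 hv1; lra.
Qed.

End stochastic_step.

(** * Centered noise and its orthogonality to the past *)

Section noise.
Context d (T : measurableType d) (R : realType) (P : probability T R).

Local Notation int f := (P.-integrable setT (EFin \o f%R)).
Local Notation Ex f := (Rintegral P setT f%R).

Lemma integrable_sum (I : Type) (s : seq I) (h : I -> T -> R) :
  (forall i, int (h i)) ->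
  int (fun w => \sum_(i <- s) h i w) /\
  Ex (fun w => \sum_(i <- s) h i w) = \sum_(i <- s) Ex (h i).
Proof.
move=> ih; elim: s => [|i s [is_ Es]].
  under eq_fun do rewrite big_nil.
  by rewrite big_nil Rintegral_prob_cst; split=> //; exact: integrable_cst.
under eq_fun do rewrite big_cons.
by rewrite big_cons -Es -RintegralD//; split=> //; exact: integrable_add.
Qed.

Lemma square_integrable_coord p (Z : T -> 'cV[R]_p) i :
  square_integrable P Z -> int (fun w => Z w i 0).
Proof.
move=> [mZ iZ].
apply: integrable_le (integrable_add iZ (integrable_cst P 1)) => [|w].
  by have /mx_measurableP := mZ; apply.
have := normr_coord_le_enorm (Z w) i.
by have := sqr_ge0 (enorm (Z w) - 1); have := sqr_ge0 (enorm (Z w)); lra.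
Qed.

(** Square integrability of the centered vector, the one that sigma_f bounds, makes [Z] itself
    integrable; hence [fine] in [expect_mx] returns the true mean and not its default value. *)
Lemma Rintegral_sub_expect_mx p (Z : T -> 'cV[R]_p) i :
  square_integrable P (fun w => Z w - expect_mx P Z) ->
  Ex (fun w => (Z w - expect_mx P Z) i 0) = 0.
Proof.
move=> sZ; have iZc := square_integrable_coord i sZ.
have iZ : int (fun w => Z w i 0).
  have := integrable_add iZc (integrable_cst P (expect_mx P Z i 0)).
  by under eq_fun do rewrite !mxE subrK.
under eq_Rintegral do rewrite !mxE.
rewrite RintegralB//; last exact: integrable_cst.
by rewrite Rintegral_prob_cst unlock /Rintegral subrr.
Qed.

Lemma Rintegral_dotv_cst p (Z : T -> 'cV[R]_p) (h : 'cV[R]_p) :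
  square_integrable P (fun w => Z w - expect_mx P Z) ->
  int (fun w => dotv (Z w) h) /\
  Ex (fun w => dotv (Z w) h) = dotv (expect_mx P Z) h.
Proof.
move=> sZ; set c := expect_mx P Z.
have hi i : int (fun w => (Z w - c) i 0 * h i 0).
  under eq_fun do rewrite mulrC.
  exact/integrable_scale/square_integrable_coord.
have [i1 E1] := integrable_sum (index_enum 'I_p) hi.
have E0 : Ex (fun w => dotv (Z w - c) h) = 0.
  under eq_Rintegral do rewrite dotvE.
  rewrite E1 big1// => i _; under eq_Rintegral do rewrite mulrC.
  by rewrite RintegralZl ?Rintegral_sub_expect_mx ?mulr0//; exact: square_integrable_coord.
have i0 : int (fun w => dotv (Z w - c) h) by under eq_fun do rewrite dotvE.
have ZE : (fun w => dotv (Z w) h) = (fun w => dotv (Z w - c) h + dotv c h).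
  by apply/funext => w; rewrite -dotvDl subrK.
rewrite ZE; split; first exact/integrable_add/integrable_cst.
rewrite RintegralD//; last exact: integrable_cst.
by rewrite E0 add0r Rintegral_prob_cst.
Qed.

Lemma indep_Rintegral_dotv0 p d' (X : measurableType d') (F : set (set T))
    (Phi : T -> X) (g : X -> 'cV[R]_p) (v : T -> 'cV[R]_p) :
  F `<=` measurable -> measurable_fun setT Phi -> indep_of P Phi F ->
  mx_measurable measurable g -> mx_measurable F v ->
  square_integrable P (fun w => g (Phi w)) ->
  (forall i, Ex (fun w => g (Phi w) i 0) = 0) ->
  square_integrable P v -> Ex (fun w => dotv (g (Phi w)) (v w)) = 0.
Proof.
move=> Fm mPhi ind mg vF sg g0 sv; have [mgP ig] := sg; have [mv iv] := sv.
have hi i : int (fun w => g (Phi w) i 0 * v w i 0).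
  apply: integrable_le (integrable_add ig iv) => [|w].
    by apply: measurable_funM; [move/mx_measurableP: mgP|move/mx_measurableP: mv]; apply.
  have := normr_coord_le_enorm (g (Phi w)) i.
  have := normr_coord_le_enorm (v w) i.
  rewrite normrM; have := normr_ge0 (g (Phi w) i 0); have := normr_ge0 (v w i 0).
  by have := sqr_ge0 (enorm (g (Phi w)) - enorm (v w)); nra.
under eq_Rintegral do rewrite dotvE.
have [_ ->] := integrable_sum (index_enum 'I_p) hi.
apply: big1 => i _.
apply: (@indep_Rintegral_mul0 _ _ _ _ _ _ F Phi (fun z => g z i 0) (fun w => v w i 0)) => //.
- by move/mx_measurableP: mg; apply.
- by move=> B mB; apply: vF; exists i, 0, B.
- exact: square_integrable_coord.
Qed.

Lemma mx_measurable_subr (F : set (set T)) p q (v : T -> 'M[R]_(p, q)) c :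
  mx_measurable F v -> mx_measurable F (fun w => v w - c).
Proof.
move=> vF _ [i [j [B [mB ->]]]]; apply: vF.
exists i, j, ((fun x => x - c i j) @^-1` B); split.
  rewrite -[X in measurable X]setTI.
  by apply: measurable_funB; [exact: measurable_id|exact: measurable_cst| |].
by apply/funext => w /=; rewrite !mxE.
Qed.

End noise.

(** * The feedback error and its second moment *)

Section perturbation.
Context (R : realType) (m d : nat) (X : Type).
Variables (A : X -> 'M[R]_d) (b : X -> 'cV[R]_d).
Variables (C D : 'M[R]_(m, d)) (r : nat -> 'cV[R]_d).
Variables (gx : nat -> 'cV[R]_d -> R) (gy : nat -> 'cV[R]_m -> R).
Variables (n : nat) (L : R).
Hypotheses (dx : forall x, differentiable (gx n) x)
  (dy : forall y, differentiable (gy n) y).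
Hypotheses (lx : lipschitz_grad L (gx n)) (ly : lipschitz_grad L (gy n)).

(** The error splits into (Ao - A)^T applied to the measured gradients and A^T applied to the
    gradient errors. The first part needs the size of the gradients, hence their values at the
    origin. *)
Lemma grad_est_sub_le Ao xh yh v z :
  let x := phi_map A b v z in let y := out_map C D r n x in
  let p := opnorm (Ao - A z) in let a := opnorm (A z) in let c := opnorm C in
  let ex := enorm (xh - x) in let ey := enorm (yh - y) in
  is_true (
  enorm (grad_est C gx gy n Ao xh yh - grad_cost A b C D r gx gy n v z) <=
  p * (c * (enorm (grad (gy n) 0) + `|L| * (enorm y + ey))
       + (enorm (grad (gx n) 0) + `|L| * (enorm x + ex)))
  + a * (c * (`|L| * ey) + `|L| * ex)).
Proof.
move=> x y p a c ex ey.
rewrite (grad_costE _ _ _ _ _ dx dy) /grad_est -/x -/y.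
have p0 : 0 <= p by exact: opnorm_ge0.
have a0 : 0 <= a by exact: opnorm_ge0.
have c0 : 0 <= c by exact: opnorm_ge0.
pose wy := grad (gy n) yh; pose wx := grad (gx n) xh.
have -> : Ao^T *m C^T *m wy + Ao^T *m wx
    - ((A z)^T *m C^T *m grad (gy n) y + (A z)^T *m grad (gx n) x) =
    (Ao - A z)^T *m (C^T *m wy + wx)
    + (A z)^T *m (C^T *m (wy - grad (gy n) y) + (wx - grad (gx n) x)).
  rewrite linearB /= !mulmxBl !mulmxDr !mulmxN !mulmxA.
  by apply/matrixP => i j; rewrite !mxE; ring.
rewrite (le_trans (ler_enormD _ _))// lerD//.
  rewrite (le_trans (enorm_trmx_mulmx _ _))// ler_wpM2l//.
  rewrite (le_trans (ler_enormD _ _))// lerD//.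
    rewrite (le_trans (enorm_trmx_mulmx _ _))// ler_wpM2l//.
    rewrite (le_trans (enorm_grad_le _ ly))// lerD2l ler_wpM2l//.
    by rewrite -[yh](subrK y) addrC (le_trans (ler_enormD _ _))// lerD2l /ey.
  rewrite (le_trans (enorm_grad_le _ lx))// lerD2l ler_wpM2l//.
  by rewrite -[xh](subrK x) addrC (le_trans (ler_enormD _ _))// lerD2l /ex.
rewrite (le_trans (enorm_trmx_mulmx _ _))// ler_wpM2l//.
rewrite (le_trans (ler_enormD _ _))// lerD//; last exact: lipschitz_gradW.
rewrite (le_trans (enorm_trmx_mulmx _ _))// ler_wpM2l//.
exact: lipschitz_gradW.
Qed.

Lemma enorm_phi_map_le v z :
  enorm (phi_map A b v z) <= opnorm (A z) * enorm v + enorm (b z).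
Proof. by rewrite (le_trans (ler_enormD _ _))// lerD2r enorm_mulmx. Qed.

Lemma enorm_out_map_le x :
  enorm (out_map C D r n x) <= opnorm C * enorm x + opnorm D * enorm (r n).
Proof. by rewrite (le_trans (ler_enormD _ _))// lerD ?enorm_mulmx. Qed.

End perturbation.

Section perturbation_moment.
Context (R : realType).

(** One factor k for both brackets of [grad_est_sub_le], once |x| and |y| are bounded in terms of
    |A| and |b|; c and dn stand for the norms of C and D, and G bounds the gradients at the
    origin. *)
Definition perturbation_rate (bU L sigmaD c dn G : R) : R :=
  (1 + c) * G + c * L * (dn * sigmaD) + L * (1 + c ^+ 2) * (bU + 1) + L * (1 + c).

(** Means of the terms of [sqr_perturbation_le], divided by e^2, for e <= 1: 1 comes from p^4, 3 + 2
    sigmaD^4 bounds the mean of 1 + a^4 + t^4 + ey^4 + ex^4, and the last summand comes from the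
    term with k^2. *)
Definition perturbation_cst (bU L sigmaD c dn G : R) : R :=
  let k := perturbation_rate bU L sigmaD c dn G in
  1 + 125 * k ^+ 4 * (3 + 2 * sigmaD ^+ 4) + 4 * k ^+ 2 * (1 + sigmaD ^+ 4).

Lemma perturbation_cst_ge1 bU L sigmaD c dn G :
  1 <= perturbation_cst bU L sigmaD c dn G.
Proof.
rewrite /perturbation_cst !(exprM _ 2 2) -addrA lerDl.
by do ?[done|exact: sqr_ge0|apply: addr_ge0|apply: mulr_ge0].
Qed.

Lemma sqr_add5_le (x1 x2 x3 x4 x5 : R) :
  (x1 + x2 + x3 + x4 + x5) ^+ 2 <=
  5 * (x1 ^+ 2 + x2 ^+ 2 + x3 ^+ 2 + x4 ^+ 2 + x5 ^+ 2).
Proof.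
have := (sqr_ge0 (x1 - x2), sqr_ge0 (x1 - x3), sqr_ge0 (x1 - x4), sqr_ge0 (x1 - x5)).
have := (sqr_ge0 (x2 - x3), sqr_ge0 (x2 - x4), sqr_ge0 (x2 - x5)).
have := (sqr_ge0 (x3 - x4), sqr_ge0 (x3 - x5), sqr_ge0 (x4 - x5)).
by move=> [[? ?] ?] [[? ?] ?] [[[? ?] ?] ?]; lra.
Qed.

(* Both products are split by 2 s t <= e^-2 s^2 + e^2 t^2, putting e^-2 on the
   fourth powers of the errors, whose means are at most e^4. *)
Lemma sqr_perturbation_le (x p a t ey ex k e : R) :
  0 < e -> 0 <= x -> 0 <= p -> 0 <= a -> 0 <= t -> 0 <= ey -> 0 <= ex -> 0 <= k ->
  x <= p * (k * (1 + a + t + ey + ex)) + a * (k * (ey + ex)) ->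
  x ^+ 2 <= e ^- 2 * p ^+ 4
    + e ^+ 2 * (125 * k ^+ 4 * (1 + a ^+ 4 + t ^+ 4 + ey ^+ 4 + ex ^+ 4))
    + k ^+ 2 * (4 * e ^+ 2 * a ^+ 4 + 2 * e ^- 2 * (ey ^+ 4 + ex ^+ 4)).
Proof.
move=> e0 x0 p0 a0 t0 ey0 ex0 k0 hx.
pose s := 1 + a + t + ey + ex.
(* Two uses of the five-term inequality: 125 = 5^2 * 5. *)
have s4 : s ^+ 4 <= 125 * (1 + a ^+ 4 + t ^+ 4 + ey ^+ 4 + ex ^+ 4).
  have := sqr_add5_le 1 a t ey ex; rewrite -/s => h1.
  have := sqr_add5_le (1 ^+ 2) (a ^+ 2) (t ^+ 2) (ey ^+ 2) (ex ^+ 2).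
  rewrite -!exprM expr1n => h2.
  have : (s ^+ 2) ^+ 2 <= (5 * (1 ^+ 2 + a ^+ 2 + t ^+ 2 + ey ^+ 2 + ex ^+ 2)) ^+ 2.
    rewrite ler_pXn2r ?nnegrE ?sqr_ge0//.
    by do ?[done|exact: sqr_ge0|apply: addr_ge0|apply: mulr_ge0].
  by rewrite -exprM expr1n exprMn; lra.
have split2 (q y z : R) : 0 < q -> 2 * y * z <= q^-1 * y ^+ 2 + q * z ^+ 2.
  move=> q0; rewrite -(ler_pM2l q0) [leRHS]mulrDr (mulrA q q^-1) divff ?gt_eqF// mul1r.
  by have := sqr_ge0 (y - q * z); lra.
have e20 : 0 < e ^+ 2 by exact: exprn_gt0.
have h1 := split2 _ (p ^+ 2) ((k * s) ^+ 2) e20.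
have h2 := split2 _ (ey ^+ 2) (a ^+ 2) e20.
have h3 := split2 _ (ex ^+ 2) (a ^+ 2) e20.
rewrite -!exprM in h1 h2 h3.
set i := (e ^+ 2)^-1 in h1 h2 h3 *.
have hxx : x ^+ 2 <= (p * (k * s) + a * (k * (ey + ex))) ^+ 2.
  by rewrite ler_pXn2r ?nnegrE// (le_trans x0).
have h4 := sqr_ge0 (p * (k * s) - a * (k * (ey + ex))).
have h5 : 2 * (a * (k * (ey + ex))) ^+ 2 <=
    k ^+ 2 * (4 * ey ^+ 2 * a ^+ 2 + 4 * ex ^+ 2 * a ^+ 2).
  have := mulr_ge0 (sqr_ge0 k) (mulr_ge0 (sqr_ge0 a) (sqr_ge0 (ey - ex))); lra.
have h6 : k ^+ 2 * (4 * ey ^+ 2 * a ^+ 2 + 4 * ex ^+ 2 * a ^+ 2) <=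
    k ^+ 2 * (4 * e ^+ 2 * a ^+ 4 + 2 * i * (ey ^+ 4 + ex ^+ 4)).
  by rewrite ler_wpM2l ?sqr_ge0//; lra.
have h7 : e ^+ 2 * (k * s) ^+ 4 <=
    e ^+ 2 * (125 * k ^+ 4 * (1 + a ^+ 4 + t ^+ 4 + ey ^+ 4 + ex ^+ 4)).
  rewrite ler_wpM2l ?(ltW e20)// exprMn.
  have := ler_wpM2l (exprn_ge0 4 k0) s4; lra.
have h8 : 2 * (p * (k * s)) ^+ 2 = 2 * p ^+ 2 * (k * s) ^+ 2 by rewrite exprMn mulrA.
lra.
Qed.

End perturbation_moment.

Section perturbation_integral.
Context d (T : measurableType d) (R : realType) (P : probability T R).

Local Notation int f := (P.-integrable setT (EFin \o f%R)).
Local Notation Ex f := (Rintegral P setT f%R).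

(** A free bound [e] replaces the measurement error, because the estimate divides by e^2; zero error
    is then reached by letting [e] tend to 0. *)
Lemma perturbation_moment q (Xi : T -> 'cV[R]_q) (p a t ey ex : T -> R)
    (bU L sigmaD c dn G e : R) :
  let k := perturbation_rate bU L sigmaD c dn G in
  0 < e <= 1 -> 0 <= k -> mx_measurable measurable Xi ->
  (forall w, [/\ 0 <= p w, 0 <= a w, 0 <= t w, 0 <= ey w & 0 <= ex w]) ->
  (forall w, enorm (Xi w) <= p w * (k * (1 + a w + t w + ey w + ex w))
                             + a w * (k * (ey w + ex w))) ->
  int (fun w => p w ^+ 4) /\ Ex (fun w => p w ^+ 4) <= e ^+ 4 ->
  int (fun w => a w ^+ 4) /\ Ex (fun w => a w ^+ 4) <= sigmaD ^+ 4 ->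
  int (fun w => t w ^+ 4) /\ Ex (fun w => t w ^+ 4) <= sigmaD ^+ 4 ->
  int (fun w => ey w ^+ 4) /\ Ex (fun w => ey w ^+ 4) <= e ^+ 4 ->
  int (fun w => ex w ^+ 4) /\ Ex (fun w => ex w ^+ 4) <= e ^+ 4 ->
  square_integrable P Xi /\
  Ex (fun w => enorm (Xi w) ^+ 2) <=
    (perturbation_cst bU L sigmaD c dn G * e) ^+ 2.
Proof.
move=> k /andP[e0 e1] k0 mXi nn hXi [ip hp] [ia ha] [it ht] [iy hy] [ix hx].
pose k4 := e ^+ 2 * (125 * k ^+ 4); pose i := (e ^+ 2)^-1.
have iS (l : R) (h : T -> R) : int h -> int (fun w => l * h w) by exact: integrable_scale.
have iA (h h' : T -> R) : int h -> int h' -> int (fun w => h w + h' w).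
  exact: integrable_add.
have iC (l : R) : int (fun=> l) by exact: integrable_cst.
pose bnd w := i * p w ^+ 4 + (k4 + 4 * k ^+ 2 * e ^+ 2) * a w ^+ 4
  + k4 * t w ^+ 4 + (k4 + 2 * k ^+ 2 * i) * ey w ^+ 4
  + (k4 + 2 * k ^+ 2 * i) * ex w ^+ 4 + k4.
have le_bnd w : enorm (Xi w) ^+ 2 <= bnd w.
  have [? ? ? ? ?] := nn w.
  have := @sqr_perturbation_le _ (enorm (Xi w)) (p w) (a w) (t w) (ey w) (ex w) k e.
  move=> /(_ e0 (enorm_ge0 _)); rewrite hXi => /(_ _ _ _ _ _ _ isT) h.
  by rewrite (le_trans (h _ _ _ _ _ _))// /bnd /k4 -/i; lra.
have ib : int bnd.
  rewrite /bnd.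
  by repeat first [assumption | apply: (iA) | apply: (iS) | apply: (iC)].
have iXi : int (fun w => enorm (Xi w) ^+ 2).
  apply: integrable_le ib => [|w]; last by rewrite ger0_norm ?sqr_ge0.
  by apply: measurable_funX; exact: measurable_enorm.
split=> //; apply: (le_trans (Rintegral_le iXi ib le_bnd)); rewrite /bnd.
do 5 (rewrite RintegralD//;
  try solve [repeat first [assumption | apply: (iA) | apply: (iS) | apply: (iC)]]).
rewrite !RintegralZl// Rintegral_prob_cst.
have e20 : 0 < e ^+ 2 by exact: exprn_gt0.
have i0 : 0 <= i by rewrite invr_ge0 ltW.
have ie : i * e ^+ 4 = e ^+ 2 by rewrite /i; field; rewrite gt_eqF.
have k40 : 0 <= k4 by do ?[done|exact: exprn_ge0|exact: ltW|apply: mulr_ge0].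
have k20 : 0 <= k ^+ 2 by exact: sqr_ge0.
have e41 : e ^+ 4 <= 1 by rewrite exprn_ile1// ltW.
have h1 := ler_wpM2l i0 hp.
have c2 : 0 <= k4 + 4 * k ^+ 2 * e ^+ 2.
  by do ?[done|exact: sqr_ge0|apply: addr_ge0|apply: mulr_ge0].
have h2 := ler_wpM2l c2 ha.
have h3 := ler_wpM2l k40 ht.
have c4 : 0 <= k4 + 2 * k ^+ 2 * i.
  by do ?[done|exact: sqr_ge0|apply: addr_ge0|apply: mulr_ge0].
have h4 := ler_wpM2l c4 hy.
have h5 := ler_wpM2l c4 hx.
have h6 := ler_wpM2l k40 e41.
set s4 := sigmaD ^+ 4 in ha ht h2 h3.
have s40 : 0 <= s4 by rewrite /s4 (exprM _ 2 2) sqr_ge0.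
set cst := perturbation_cst _ _ _ _ _ _.
have cstE : cst = 1 + 125 * k ^+ 4 * (3 + 2 * s4) + 4 * k ^+ 2 * (1 + s4) by [].
have cst1 : 1 <= cst by exact: perturbation_cst_ge1.
(* The moment bound is linear in [cst]; since cst >= 1 it can be stated as a square, the form taken
   by the step estimate. *)
have cc : cst * e ^+ 2 <= (cst * e) ^+ 2.
  by rewrite exprMn ler_wpM2r ?sqr_ge0// expr2 ler_peMl// (le_trans ler01).
apply: le_trans cc; rewrite cstE.
have c4e : (k4 + 2 * k ^+ 2 * i) * e ^+ 4 = k4 * e ^+ 4 + 2 * k ^+ 2 * e ^+ 2.
  by rewrite -ie; ring.
rewrite c4e in h4 h5; rewrite ie in h1.
have k4E : k4 = e ^+ 2 * (125 * k ^+ 4) by [].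
have k4s : k4 * s4 = e ^+ 2 * (125 * k ^+ 4) * s4 by [].
lra.
Qed.

End perturbation_integral.

(** * Measurability of the cost, its gradient and the surrogate *)

Section measurable_cost.
Context dS dX (S : measurableType dS) (X : measurableType dX) (R : realType).
Context (m d : nat).
Variables (A : X -> 'M[R]_d) (b : X -> 'cV[R]_d).
Variables (C D : 'M[R]_(m, d)) (r : nat -> 'cV[R]_d).
Variables (gx : nat -> 'cV[R]_d -> R) (gy : nat -> 'cV[R]_m -> R).
Variables (V : S -> 'cV[R]_d) (Z : S -> X).
Hypotheses (mA : mx_measurable measurable A) (mb : mx_measurable measurable b).
Hypotheses (mV : mx_measurable measurable V) (mZ : measurable_fun setT Z).

Lemma mx_measurable_comp p q (M : X -> 'M[R]_(p, q)) :
  mx_measurable measurable M -> mx_measurable measurable (fun s => M (Z s)).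
Proof.
move=> /mx_measurableP mM; apply/mx_measurableP => i j.
exact: (measurableT_comp (mM i j) mZ).
Qed.

Lemma mx_measurable_phi_map :
  mx_measurable measurable (fun s => phi_map A b (V s) (Z s)).
Proof.
by apply: mx_measurableD; [apply: mx_measurableM => //|]; exact: mx_measurable_comp.
Qed.

Lemma mx_measurable_out_map n :
  mx_measurable measurable (fun s => out_map C D r n (phi_map A b (V s) (Z s))).
Proof.
apply: mx_measurableD; last exact: mx_measurable_cst.
by apply: mx_measurableM; [exact: mx_measurable_cst|exact: mx_measurable_phi_map].
Qed.

Variable n : nat.
Hypotheses (cdx : continuously_differentiable (gx n))
  (cdy : continuously_differentiable (gy n)).

(** The source space is general to cover random decisions, with S = T, as well as the gradient as a
    function on X, with S = X and Z the identity. *)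
Lemma mx_measurable_grad_cost :
  mx_measurable measurable (fun s => grad_cost A b C D r gx gy n (V s) (Z s)).
Proof.
have [dx cx] := cdx; have [dy cy] := cdy.
under eq_fun do rewrite (grad_costE _ _ _ _ _ dx dy).
have mAT := mx_measurable_trmx (mx_measurable_comp mA).
apply: mx_measurableD; apply: mx_measurableM => //.
- by apply: mx_measurableM => //; exact: mx_measurable_cst.
- exact/mx_measurable_continuous_comp/mx_measurable_out_map.
- exact/mx_measurable_continuous_comp/mx_measurable_phi_map.
Qed.

Lemma measurable_cost :
  measurable_fun setT (fun s => cost A b C D r gx gy n (V s) (Z s)).
Proof.
have [dx _] := cdx; have [dy _] := cdy.
apply: measurable_funD.
  apply: (@measurable_continuous_comp_mx _ _ _ _ _ (gx n) _ _
    mx_measurable_phi_map) => v.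
  exact: differentiable_continuous.
apply: (@measurable_continuous_comp_mx _ _ _ _ _ (gy n) _ _
  (@mx_measurable_out_map n)) => v.
exact: differentiable_continuous.
Qed.

Lemma mx_measurable_grad_est (Ao : S -> 'M[R]_d) (xh : S -> 'cV[R]_d)
    (yh : S -> 'cV[R]_m) :
  mx_measurable measurable Ao -> mx_measurable measurable xh ->
  mx_measurable measurable yh ->
  mx_measurable measurable (fun s => grad_est C gx gy n (Ao s) (xh s) (yh s)).
Proof.
move=> mAo mxh myh; have [dx cx] := cdx; have [dy cy] := cdy.
have mAT := mx_measurable_trmx mAo.
apply: mx_measurableD; apply: mx_measurableM => //.
- by apply: mx_measurableM => //; exact: mx_measurable_cst.
- exact: mx_measurable_continuous_comp.
- exact: mx_measurable_continuous_comp.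
Qed.

End measurable_cost.

(** * Tracking error of the projected feedback algorithm *)

Section tracking.
Context (R : realType) (m d : nat) (dT dX : measure_display).
Context (T : measurableType dT) (P : probability T R) (X : measurableType dX).
Variables (Phi : nat -> T -> X).
Variables (A : X -> 'M[R]_d) (b : X -> 'cV[R]_d).
Variables (C D : 'M[R]_(m, d)) (r : nat -> 'cV[R]_d).
Variables (gx : nat -> 'cV[R]_d -> R) (gy : nat -> 'cV[R]_m -> R).
Variables (U : nat -> set 'cV[R]_d) (ustar : nat -> 'cV[R]_d).
Variables (u xhat : nat -> T -> 'cV[R]_d) (yhat : nat -> T -> 'cV[R]_m).
Variables (Ao : nat -> T -> 'M[R]_d).
Variables (mu Lg bU sigmaD epsm Lf muf sigmaf gammab alpha : R).

Local Notation int f := (P.-integrable setT (EFin \o f%R)).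
Local Notation Ex f := (Rintegral P setT f%R).
Local Notation f := (cost A b C D r gx gy).
Local Notation gradf := (grad_cost A b C D r gx gy).
Local Notation F := (history (u 0%N)
  (fun n w => A (Phi n w)) (fun n w => b (Phi n w))).
Local Notation x n w := (phi_map A b (u n w) (Phi n.+1 w)).
Local Notation y n w := (out_map C D r n (x n w)).
Local Notation util n w := (u n w - ustar n).
Local Notation gradftil n w :=
  (gradf n (u n w) (Phi n.+1 w) - gradf n (ustar n) (Phi n.+1 w)).
Local Notation gbar n :=
  (expect_mx P (fun w => gradf n (ustar n) (Phi n.+1 w))).
Local Notation noise n w := (gradf n (ustar n) (Phi n.+1 w) - gbar n).
Local Notation pert n w := (grad_est C gx gy n (Ao n.+1 w) (xhat n w) (yhat n w)
  - gradf n (u n w) (Phi n.+1 w)).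
Local Notation mse n := (Ex (fun w => enorm (util n w) ^+ 2)).

Hypothesis mPhi : forall n, measurable_fun setT (Phi n).
Hypotheses (mA : mx_measurable measurable A) (mb : mx_measurable measurable b).
Hypothesis mu_ : forall n, mx_measurable measurable (u n).
Hypothesis mxhat : forall n, mx_measurable measurable (xhat n).
Hypothesis myhat : forall n, mx_measurable measurable (yhat n).
Hypothesis mAo : forall n, mx_measurable measurable (Ao n.+1).
Hypothesis uF : forall n, mx_measurable (F n) (u n).
Hypothesis ind : forall n, indep_of P (Phi n.+1) (F n).
Hypothesis opt : forall n, U n (ustar n) /\
  forall v, U n v ->
    ('E_P[fun w => f n (ustar n) (Phi n.+1 w)] <=
     'E_P[fun w => f n v (Phi n.+1 w)])%E.
Hypotheses (Lf0 : 0 <= Lf) (muf0 : 0 < muf) (sigmaf0 : 0 <= sigmaf).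
Hypothesis gradf_lip : forall n,
  condE_le P (F n) (fun w => enorm (gradftil n w) ^+ 2)
    (fun w => Lf ^+ 2 * enorm (util n w) ^+ 2).
Hypothesis gradf_mono : forall n,
  condE_ge P (F n) (fun w => dotv (gradftil n w) (util n w))
    (fun w => muf * enorm (util n w) ^+ 2).
Hypothesis noise_le : forall n,
  condE_le P (F n) (fun w => enorm (noise n w) ^+ 2) (fun=> sigmaf ^+ 2).
Hypothesis mu0 : 0 < mu.
Hypothesis gxP : forall n, [/\ strongly_convex mu (gx n),
  continuously_differentiable (gx n) & lipschitz_grad Lg (gx n)].
Hypothesis gyP : forall n, [/\ strongly_convex mu (gy n),
  continuously_differentiable (gy n) & lipschitz_grad Lg (gy n)].
Hypothesis cU : forall n, convex_set (U n).
Hypothesis bUP : ereal_sup [set ereal_sup [set (enorm v)%:E | v in U n] |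
  n in [set n | (1 <= n)%N]] = bU%:E.
Hypothesis momA : forall n,
  condE_le P (F n) (fun w => opnorm (A (Phi n.+1 w)) ^+ 4) (fun=> sigmaD ^+ 4).
Hypothesis momb : forall n,
  condE_le P (F n) (fun w => enorm (b (Phi n.+1 w)) ^+ 4) (fun=> sigmaD ^+ 4).
Hypothesis rP : forall n, enorm (r n) <= sigmaD.
Hypothesis epsm0 : 0 <= epsm.
Hypothesis momy : forall n,
  condE_le P (F n) (fun w => enorm (yhat n w - y n w) ^+ 4) (fun=> epsm ^+ 4).
Hypothesis momx : forall n,
  condE_le P (F n) (fun w => enorm (xhat n w - x n w) ^+ 4) (fun=> epsm ^+ 4).
Hypothesis momAo : forall n,
  condE_le P (F n) (fun w => opnorm (Ao n.+1 w - A (Phi n.+1 w)) ^+ 4)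
    (fun=> epsm ^+ 4).
Hypothesis algo : forall n w, is_proj (U n)
  (u n w - alpha *: grad_est C gx gy n (Ao n.+1 w) (xhat n w) (yhat n w))
  (u n.+1 w).
Hypothesis driftP : forall n, enorm (ustar n.+1 - ustar n) <= gammab.
Hypotheses (alpha0 : 0 < alpha) (alpha_lt : alpha * Lf ^+ 2 < muf).

Let cdx n : continuously_differentiable (gx n). Proof. by have [] := gxP n. Qed.
Let cdy n : continuously_differentiable (gy n). Proof. by have [] := gyP n. Qed.
Let dx n z : differentiable (gx n) z. Proof. by have [+ _] := cdx n. Qed.
Let dy n z : differentiable (gy n) z. Proof. by have [+ _] := cdy n. Qed.
Let lx n : lipschitz_grad Lg (gx n). Proof. by have [] := gxP n. Qed.
Let ly n : lipschitz_grad Lg (gy n). Proof. by have [] := gyP n. Qed.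
Let cvx n : strongly_convex mu (gx n). Proof. by have [] := gxP n. Qed.
Let cvy n : strongly_convex mu (gy n). Proof. by have [] := gyP n. Qed.

Let FT n : F n setT.
Proof. by rewrite -[setT]setC0; apply: sigma_algebraC; exact: sigma_algebra0. Qed.

Let Fm n : F n `<=` measurable.
Proof.
apply: smallest_sub; first exact: sigma_algebra_measurable.
rewrite subUset; split; first exact: mu_.
by move=> S [k _ [|]]; apply: mx_measurable_comp.
Qed.

Let condE_le_cst n (Z : T -> R) c : measurable_fun setT Z ->
  (forall w, 0 <= Z w) -> 0 <= c -> condE_le P (F n) Z (fun=> c) ->
  int Z /\ Ex Z <= c.
Proof.
move=> mZ Z0 c0 h; rewrite -[leRHS](Rintegral_prob_cst P).
exact: (condE_le_Rintegral (@FT n) (@Fm n) mZ Z0 (fun=> c0) (integrable_cst P c) h).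
Qed.

Let enorm_le n v : (1 <= n)%N -> U n v -> enorm v <= bU.
Proof.
move=> n1 Unv; rewrite -lee_fin -bUP.
apply: (@le_trans _ _ (ereal_sup [set (enorm v)%:E | v in U n])).
  by apply: ereal_sup_ubound; exists v.
by apply: ereal_sup_ubound; exists n.
Qed.

Let bU0 : 0 <= bU.
Proof. exact: le_trans (enorm_ge0 _) (enorm_le (leqnn 1) (opt 1).1). Qed.

Let sigmaD0 : 0 <= sigmaD.
Proof. exact: le_trans (enorm_ge0 _) (rP 0). Qed.

Let gammab0 : 0 <= gammab.
Proof. exact: le_trans (enorm_ge0 _) (driftP 0). Qed.

(** Since u_(n+1) lies in U_n and the supremum [bU] starts at U_1, the bound begins with u_2. *)
Let u_le n w : (2 <= n)%N -> enorm (u n w) <= bU.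
Proof. by case: n => [//|n n1]; apply: (enorm_le n1); have [] := algo n w. Qed.

Let util_le n w : (2 <= n)%N -> enorm (util n w) <= 2 * bU.
Proof.
move=> n2; rewrite (le_trans (ler_enormB _ _))// mulr2n mulrDl !mul1r lerD ?u_le//.
by apply: (@enorm_le n); [exact: ltnW|exact: (opt n).1].
Qed.

Let mutil n : mx_measurable measurable (fun w => util n w).
Proof. exact: mx_measurable_subr. Qed.

Let mgradf n : mx_measurable measurable (fun w => gradf n (u n w) (Phi n.+1 w)).
Proof. exact: mx_measurable_grad_cost. Qed.

Let mgradfstar n z :
  mx_measurable measurable (fun w => gradf n z (Phi n.+1 w)).
Proof. by apply: mx_measurable_grad_cost => //; exact: mx_measurable_cst. Qed.

Let mpert n : mx_measurable measurable (fun w => pert n w).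
Proof. by apply: mx_measurableB => //; exact: mx_measurable_grad_est. Qed.

Let sutil n : (2 <= n)%N -> square_integrable P (fun w => util n w).
Proof. by move=> n2; exact: square_integrable_bounded (fun w => util_le w n2). Qed.

Let sgradftil n : (2 <= n)%N -> square_integrable P (fun w => gradftil n w) /\
  Ex (fun w => enorm (gradftil n w) ^+ 2) <= Lf ^+ 2 * mse n.
Proof.
move=> n2; have [_ iu] := sutil n2.
have mg : mx_measurable measurable (fun w => gradftil n w).
  exact: mx_measurableB.
have [||||ig Eg] := condE_le_Rintegral (@FT n) (@Fm n) _ _ _ _ (gradf_lip n).
- by apply: measurable_funX; exact: measurable_enorm.
- by move=> w; exact: sqr_ge0.
- by move=> w; rewrite mulr_ge0 ?sqr_ge0.
- exact: integrable_scale.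
by split=> //; rewrite -RintegralZl.
Qed.

Let gradftil_mono n : (2 <= n)%N ->
  muf * mse n <= Ex (fun w => dotv (gradftil n w) (util n w)).
Proof.
move=> n2; have [_ iu] := sutil n2; rewrite -RintegralZl//.
apply: (condE_ge_Rintegral (@FT n) (@Fm n)) (gradf_mono n).
- by apply: square_integrable_dotv; [have [] := sgradftil n2|exact: sutil].
- by move=> w; rewrite mulr_ge0 ?sqr_ge0 ?(ltW muf0).
- exact: integrable_scale.
Qed.

Let snoise n : square_integrable P (fun w => noise n w) /\
  Ex (fun w => enorm (noise n w) ^+ 2) <= sigmaf ^+ 2.
Proof.
have mn : mx_measurable measurable (fun w => noise n w).
  exact: mx_measurable_subr (@mgradfstar n (ustar n)).
have [|||i E] := condE_le_cst _ _ _ (noise_le n) => //.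
- by apply: measurable_funX; exact: measurable_enorm.
- by move=> w; exact: sqr_ge0.
- exact: sqr_ge0.
Qed.

Let noise_orth n : (2 <= n)%N -> Ex (fun w => dotv (noise n w) (util n w)) = 0.
Proof.
move=> n2; have [sn _] := snoise n.
apply: (@indep_Rintegral_dotv0 _ _ _ _ _ _ _ (F n) (Phi n.+1)
  (fun z => gradf n (ustar n) z - gbar n) (fun w => util n w)) => //.
- apply: mx_measurable_subr.
  (* Independence asks for the noise as a measurable function on X evaluated at [Phi n.+1], hence
     the identity on X. *)
  apply: (@mx_measurable_grad_cost _ _ _ _ _ _ _ A b C D r gx gy
    (cst (ustar n)) idfun) => //; first exact: mx_measurable_cst.
  exact: measurable_id.
- exact: mx_measurable_subr.
- by move=> i; apply: Rintegral_sub_expect_mx.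
- exact: sutil.
Qed.

Let momA' n : int (fun w => opnorm (A (Phi n.+1 w)) ^+ 4) /\
  Ex (fun w => opnorm (A (Phi n.+1 w)) ^+ 4) <= sigmaD ^+ 4.
Proof.
apply: condE_le_cst (momA n) => //; last exact: exprn_ge0.
- by apply/measurable_funX/measurable_opnorm/mx_measurable_comp.
- by move=> w; rewrite exprn_ge0 ?opnorm_ge0.
Qed.

Let momb' n : int (fun w => enorm (b (Phi n.+1 w)) ^+ 4) /\
  Ex (fun w => enorm (b (Phi n.+1 w)) ^+ 4) <= sigmaD ^+ 4.
Proof.
apply: condE_le_cst (momb n) => //; last exact: exprn_ge0.
- by apply/measurable_funX/measurable_enorm/mx_measurable_comp.
- by move=> w; rewrite exprn_ge0 ?enorm_ge0.
Qed.

Let int_cost n v : int (fun w => f n v (Phi n.+1 w)).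
Proof.
have [k [k0 hk]] := normr_cost_le A b C D r (ltW mu0) (cvx n) (cvy n)
  (@dx n) (@dy n) (@lx n) (@ly n) v.
have [iA _] := momA' n; have [ib _] := momb' n.
apply: integrable_le (integrable_scale k
  (integrable_add (integrable_add (integrable_cst P 1) iA) ib)) => //.
by apply: measurable_cost => //; exact: mx_measurable_cst.
Qed.

(** The segment from [ustar n] to v stays in [U n]; [cost_ge] and [cost_le] enclose the cost along
    it, with a curvature factor proportional to |A|^2, integrable by the fourth moment. *)
Let gbar_ge0 n v : U n v -> 0 <= dotv (gbar n) (v - ustar n).
Proof.
move=> Uv; have [sn _] := snoise n; have [Us opts] := opt n.
have [ig <-] := Rintegral_dotv_cst (v - ustar n) sn.
have [iA _] := momA' n.
pose k := `|Lg| * (1 + opnorm C ^+ 2) * enorm (v - ustar n) ^+ 2.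
pose ut t := t *: v + (1 - t) *: ustar n.
have utE t : ut t - ustar n = t *: (v - ustar n).
  by apply/matrixP => i j; rewrite !mxE; ring.
apply: (@variational_inequality _ _ _ P (fun w => f n (ustar n) (Phi n.+1 w))
  (fun t w => f n (ut t) (Phi n.+1 w)) _
  (fun w => k * opnorm (A (Phi n.+1 w)) ^+ 2)) => //.
- apply: integrable_scale.
  apply: integrable_le (integrable_add (integrable_cst P 1) iA) => [|w].
    by apply/measurable_funX/measurable_opnorm/mx_measurable_comp.
  rewrite ger0_norm ?sqr_ge0//.
  have := sqr_ge0 (opnorm (A (Phi n.+1 w))).
  by have := sqr_ge0 (opnorm (A (Phi n.+1 w)) ^+ 2 - 1); lra.
- move=> t _ _; apply: measurable_cost => //; exact: mx_measurable_cst.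
- move=> t w t0 t1; apply/andP; split.
    have := cost_ge A b C D r (ltW mu0) (cvx n) (cvy n) (@dx n) (@dy n)
      (ustar n) (ut t) (Phi n.+1 w).
    by rewrite utE dotvZr.
  have := cost_le A b C D r (ltW mu0) (cvx n) (cvy n) (@dx n) (@dy n)
    (@lx n) (@ly n) (ustar n) (ut t) (Phi n.+1 w).
  by rewrite utE dotvZr enormZ exprMn real_normK ?num_real// /k; lra.
- move=> t t0 t1; have := opts (ut t); rewrite unlock; apply.
  by apply: convex_set_segment => //; rewrite !ltW.
Qed.

Let mse_ge0 n : 0 <= mse n.
Proof. by apply: Rintegral_ge0 => w _; exact: sqr_ge0. Qed.

Lemma mse_step n xi : (2 <= n)%N -> 0 <= xi ->
  square_integrable P (fun w => pert n w) ->
  Ex (fun w => enorm (pert n w) ^+ 2) <= xi ^+ 2 ->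
  mse n.+1 <= (Num.sqrt ((1 - alpha * muf) * mse n
    + (alpha ^+ 2 * (2 * sigmaf ^+ 2 + 2 * xi ^+ 2
         + 2 * Lf * (2 * bU) * sigmaf + 2 * Lf * (2 * bU) * xi)
       + 2 * alpha * (2 * bU) * xi)) + gammab) ^+ 2.
Proof.
move=> n2 xi0 sp Ep.
have [sn En] := snoise n; have [sg Eg] := sgradftil n2.
pose v w := u n.+1 w - ustar n.
have mv : mx_measurable measurable v by exact: mx_measurable_subr.
have sv : square_integrable P v.
  apply: (@square_integrable_bounded _ _ _ _ _ _ (2 * bU)) => // w.
  rewrite (le_trans (ler_enormB _ _))// mulr2n mulrDl !mul1r lerD//.
    by apply: u_le; exact: ltnW.
  by apply: (@enorm_le n); [exact: ltnW|exact: (opt n).1].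
(* Telescoping through the true gradients at [u n] and at [ustar n]: their difference, the centered
   noise, the feedback error. *)
have decomp (p q g h k l : 'cV[R]_d) :
    p - alpha *: g - (q - alpha *: l) =
    p - q - alpha *: (h - k + (k - l) + (g - h)).
  by apply/matrixP => i j; rewrite !mxE; ring.
have step : Ex (fun w => enorm (v w) ^+ 2) <= (1 - alpha * muf) * mse n
    + (alpha ^+ 2 * (2 * sigmaf ^+ 2 + 2 * xi ^+ 2
         + 2 * Lf * (2 * bU) * sigmaf + 2 * Lf * (2 * bU) * xi)
       + 2 * alpha * (2 * bU) * xi).
  apply: (gradient_step_mse alpha0 Lf0 sigmaf0 xi0 _ (ltW alpha_lt) (@mutil n)
    (fun w => util_le w n2) sg sn sp mv Eg (gradftil_mono n2) En
    (noise_orth n2) Ep) => [|w]; first by rewrite mulr_ge0.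
  have := @is_proj_dist _ _ (U n) _ (ustar n - alpha *: gbar n) _ (ustar n)
    (@cU n) (algo n w) (opt n).1.
  rewrite addrAC subrr add0r => h; rewrite (le_trans (h _))//.
    by move=> z Uz; rewrite dotvNl dotvZl oppr_le0 mulr_ge0 ?(ltW alpha0) ?gbar_ge0.
  by rewrite (decomp _ _ _ (gradf n (u n w) (Phi n.+1 w))
    (gradf n (ustar n) (Phi n.+1 w))).
(* So far the comparison was with [ustar n]; passing to [ustar n.+1] costs [gammab] in root mean
   square. *)
have := drift_mse sv (delta := ustar n - ustar n.+1) (c := gammab).
rewrite -opprB enormN => /(_ (driftP n)).
under eq_Rintegral do rewrite opprB /v subrKA.
move=> /le_trans; apply.
rewrite ler_pXn2r ?nnegrE ?addr_ge0 ?sqrtr_ge0// lerD2r.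
exact: ler_wsqrtr.
Qed.

(** The mean of <gradftil, util> lies between muf mse and, by Cauchy-Schwarz, Lf mse; positivity of
    mse allows the division. *)
Lemma muf_le_Lf n : (2 <= n)%N -> 0 < mse n -> muf <= Lf.
Proof.
move=> n2 e0; have [sg Eg] := sgradftil n2; have [mg ig] := sg.
have [mut iu] := sutil n2.
set s := Num.sqrt (mse n).
have s0 : 0 <= s by exact: sqrtr_ge0.
have sE : s ^+ 2 = mse n by rewrite sqr_sqrtr.
have h1 : Ex (fun w => enorm (gradftil n w) ^+ 2) <= (Lf * s) ^+ 2.
  by rewrite exprMn sE.
have h2 : mse n <= s ^+ 2 by rewrite sE.
have [i h3] := Rintegral_cauchy_schwarz (measurable_enorm mg)
  (measurable_enorm mut) (mulr_ge0 Lf0 s0) s0 ig iu h1 h2.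
rewrite -(ler_pM2r e0) (le_trans (gradftil_mono n2))//.
rewrite -sE expr2 mulrA; apply: le_trans h3.
apply: Rintegral_le => // [|w].
  by apply: square_integrable_dotv; [|exact: sutil].
by rewrite !(ger0_norm (enorm_ge0 _)) dotv_le.
Qed.

Let mseE n : (2 <= n)%N ->
  ('E_P[fun w => (enorm (util n w) ^+ 2)%R] = (mse n)%:E)%E.
Proof. by move=> n2; have [_ iu] := sutil n2; rewrite unlock EFin_Rintegral. Qed.

Let mse_le n : (2 <= n)%N -> mse n <= 4 * bU ^+ 2.
Proof.
move=> n2; have [_ iu] := sutil n2.
rewrite -[leRHS](Rintegral_prob_cst P); apply: Rintegral_le => // [|w].
  exact: integrable_cst.
have -> : 4 * bU ^+ 2 = (2 * bU) ^+ 2 by ring.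
by rewrite ler_pXn2r ?nnegrE ?enorm_ge0 ?mulr_ge0// util_le.
Qed.

Let alpha_muf_le1 : muf <= Lf -> alpha * muf <= 1.
Proof.
move=> mL; rewrite -(ler_pM2r muf0) mul1r -mulrA -expr2.
apply: le_trans (ltW alpha_lt); rewrite ler_wpM2l ?(ltW alpha0)//.
by rewrite ler_pXn2r ?nnegrE ?(ltW muf0).
Qed.

Local Notation V bc := (alpha * eps_a bc muf sigmaf + eps_b bc alpha muf epsm).
Local Notation bound bc := (tracking_bound bc alpha muf sigmaf epsm gammab).
Local Notation msee N := ('E_P[fun w => (enorm (util N w) ^+ 2)%R])%E.

Let V_ge0 bc : 0 < bc -> 0 <= V bc.
Proof.
move=> /ltW bc0; apply: le_trans (eps_sum_ge muf0 alpha0 bc0 epsm0 sigmaf0).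
by rewrite !mulr_ge0// invr_ge0 ltW.
Qed.

(* If the error vanishes from some time on, nothing relates muf to Lf, hence
   the case distinction. *)
Let limn_esup_mse bc : 0 < bc ->
  (muf <= Lf -> (limn_esup (fun N => msee N) <= (bound bc)%:E)%E) ->
  (limn_esup (fun N => msee N) <= (bound bc)%:E)%E.
Proof.
move=> bc0 h; have [mL|Lm] := leP muf Lf; first exact: h.
apply: limn_esup_le => e e0; exists 2%N => n n2; rewrite mseE// lee_fin.
have -> : mse n = 0.
  apply/eqP; rewrite eq_le mse_ge0 andbT leNgt; apply/negP => /(muf_le_Lf n2).
  by rewrite leNgt Lm.
rewrite addr_ge0 ?(ltW e0)// /tracking_bound /eps_c /b_one.
do ?[done|exact: V_ge0|exact: sqr_ge0|exact: sqrtr_ge0|exact: powR_ge0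
  |exact: ltW|rewrite invr_ge0|apply: addr_ge0|apply: mulr_ge0].
Qed.

(** The right side of the last hypothesis is alpha muf V, in which muf cancels: this is the only
    condition on [bc], and it does not see muf. *)
Lemma mse_limsup bc xi : 0 < bc -> 0 <= xi ->
  (forall n, (2 <= n)%N -> square_integrable P (fun w => pert n w) /\
     Ex (fun w => enorm (pert n w) ^+ 2) <= xi ^+ 2) ->
  alpha ^+ 2 * (2 * sigmaf ^+ 2 + 2 * xi ^+ 2
    + 2 * Lf * (2 * bU) * sigmaf + 2 * Lf * (2 * bU) * xi)
    + 2 * alpha * (2 * bU) * xi <=
  alpha ^+ 2 * (bc * (2 * sigmaf ^+ 2 + sigmaf))
    + alpha * (bc * (epsm + alpha * (2 * epsm ^+ 2 + epsm))) ->
  (limn_esup (fun N => msee N) <= (bound bc)%:E)%E.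
Proof.
move=> bc0 xi0 hp; set K := (X in X <= _) => hK; apply: limn_esup_mse => // mL.
have a1 := alpha_muf_le1 mL.
have a0 : 0 < alpha * muf by exact: mulr_gt0.
apply: (@le_trans _ _ ((Num.sqrt (V bc) + 2 * gammab / (alpha * muf)) ^+ 2)%:E); last first.
  by rewrite lee_fin tracking_bound_ge ?V_ge0.
apply: (@recursion_limn_esup _ (fun n => mse n) _ _ _ _ (mse 2) 2) => //.
- by rewrite a0.
- exact: V_ge0.
move=> n n2; have [sp Ep] := hp _ n2.
apply: (le_trans (mse_step n2 xi0 sp Ep)).
rewrite ler_pXn2r ?nnegrE ?addr_ge0 ?sqrtr_ge0// lerD2r ler_wsqrtr// lerD2l.
apply: (le_trans hK); rewrite /eps_a /eps_b le_eqVlt; apply/orP; left; apply/eqP.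
by field; rewrite gt_eqF.
Qed.

(** With muf <= Lf the hypothesis gives 4 bU^2 <= bc epsm / muf <= V, and 4 bU^2 already dominates
    every mean square from time 2 on. *)
Lemma mse_limsup_trivial bc : 0 < bc -> 4 * bU ^+ 2 * Lf <= bc * epsm ->
  (limn_esup (fun N => msee N) <= (bound bc)%:E)%E.
Proof.
move=> bc0 hbc; apply: limn_esup_mse => // mL.
have a1 := alpha_muf_le1 mL.
apply: limn_esup_le => e e0; exists 2%N => n n2; rewrite mseE// lee_fin.
rewrite (le_trans (mse_le n2))//.
have hV : 4 * bU ^+ 2 <= V bc.
  apply: le_trans (eps_sum_ge muf0 alpha0 (ltW bc0) epsm0 sigmaf0).
  rewrite -mulrA ler_pdivlMl//; apply: le_trans hbc.
  by rewrite mulrC ler_wpM2l ?mulr_ge0 ?sqr_ge0.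
apply: (@le_trans _ _ (bound bc)); last by rewrite lerDl ltW.
apply: le_trans (tracking_bound_ge muf0 alpha0 a1 gammab0 (V_ge0 bc0)).
rewrite (le_trans hV)// -[leLHS](sqr_sqrtr (V_ge0 bc0)).
have g0 : 0 <= 2 * gammab / (alpha * muf).
  by rewrite divr_ge0 ?mulr_ge0 ?(ltW alpha0) ?(ltW muf0).
by rewrite ler_pXn2r ?nnegrE ?addr_ge0 ?sqrtr_ge0// lerDl.
Qed.

Lemma pert_moment G e n : (2 <= n)%N ->
  enorm (grad (gx n) 0) <= G -> enorm (grad (gy n) 0) <= G ->
  0 < e <= 1 -> epsm <= e ->
  square_integrable P (fun w => pert n w) /\
  Ex (fun w => enorm (pert n w) ^+ 2) <=
    (perturbation_cst bU `|Lg| sigmaD (opnorm C) (opnorm D) G * e) ^+ 2.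
Proof.
move=> n2 Gx Gy e01 ee; have [e0 e1] := andP e01.
have G0 : 0 <= G by exact: le_trans (enorm_ge0 _) Gx.
have ee4 : epsm ^+ 4 <= e ^+ 4 by rewrite ler_pXn2r ?nnegrE ?(ltW e0).
have mx_ : mx_measurable measurable (fun w => x n w) by exact: mx_measurable_phi_map.
have my_ : mx_measurable measurable (fun w => y n w) by exact: mx_measurable_out_map.
have mAP := mx_measurable_comp (mPhi n.+1) mA.
have err (Z : T -> R) : measurable_fun setT Z -> (forall w, 0 <= Z w) ->
    condE_le P (F n) (fun w => Z w ^+ 4) (fun=> epsm ^+ 4) ->
    int (fun w => Z w ^+ 4) /\ Ex (fun w => Z w ^+ 4) <= e ^+ 4.
  move=> mZ Z0 hZ; have [|||i E] := condE_le_cst _ _ _ hZ.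
  - exact: measurable_funX.
  - by move=> w; exact: exprn_ge0.
  - exact: exprn_ge0.
  by split=> //; exact: le_trans ee4.
have c0 : 0 <= opnorm C by exact: opnorm_ge0.
have dn0 : 0 <= opnorm D by exact: opnorm_ge0.
apply: (@perturbation_moment _ _ _ P _ _
  (fun w => opnorm (Ao n.+1 w - A (Phi n.+1 w)))
  (fun w => opnorm (A (Phi n.+1 w))) (fun w => enorm (b (Phi n.+1 w)))
  (fun w => enorm (yhat n w - y n w)) (fun w => enorm (xhat n w - x n w))) => //.
- rewrite /perturbation_rate.
  by do ?[done|exact: sqr_ge0|apply: addr_ge0|apply: mulr_ge0].
- by move=> w; split; rewrite ?enorm_ge0 ?opnorm_ge0.
- move=> w; apply: le_trans (grad_est_sub_le A b C D r (@dx n) (@dy n) (@lx n) (@ly n)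
    _ _ _ _ _) _.
  have hx := enorm_phi_map_le A b (u n w) (Phi n.+1 w).
  have hy := enorm_out_map_le C D r n (x n w).
  set p := opnorm (Ao n.+1 w - _); set a := opnorm (A _) in hx *.
  set t := enorm (b _) in hx *.
  set ey := enorm (yhat n w - _); set ex := enorm (xhat n w - _).
  set c := opnorm C in c0 hy *; set dn := opnorm D in dn0 hy *.
  set nx := enorm (x n w) in hx hy *; set ny := enorm (y n w) in hy *.
  have a0 : 0 <= a by exact: opnorm_ge0.
  have p0 : 0 <= p by exact: opnorm_ge0.
  have t0 : 0 <= t by exact: enorm_ge0.
  have ey0 : 0 <= ey by exact: enorm_ge0.
  have ex0 : 0 <= ex by exact: enorm_ge0.
  have L0 : 0 <= `|Lg| by [].
  set L := `|Lg| in L0 *.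
  have hx' : nx <= a * bU + t.
    by rewrite (le_trans hx)// lerD2r ler_wpM2l// u_le.
  have hy' : ny <= c * (a * bU + t) + dn * sigmaD.
    by rewrite (le_trans hy)// lerD ?ler_wpM2l// rP.
  apply: lerD; apply: ler_wpM2l => //.
    apply: (@le_trans _ _ (c * (G + L * ((c * (a * bU + t) + dn * sigmaD) + ey))
        + (G + L * ((a * bU + t) + ex)))).
      by rewrite lerD// ?ler_wpM2l// ?lerD// ?ler_wpM2l// ?lerD2r.
    rewrite -subr_ge0 /perturbation_rate.
    set r1 := (X in 0 <= X).
    (* The slack is a polynomial with nonnegative coefficients in nonnegative quantities; the same
       holds for the second bracket. *)
    have -> : r1 = (1 + c) * G * (a + t + ey + ex)
      + c * L * (dn * sigmaD) * (a + t + ey + ex)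
      + L * (1 + c ^+ 2) * (bU * (1 + t + ey + ex) + (1 + a + ey + ex))
      + L * (1 + c) * (1 + a + t) + L * c * ex + L * ey.
      by rewrite /r1; ring.
    by do ?[done|exact: sqr_ge0|apply: addr_ge0|apply: mulr_ge0].
  rewrite -subr_ge0 /perturbation_rate.
  set r1 := (X in 0 <= X).
  have -> : r1 = ((1 + c) * G + c * L * (dn * sigmaD) + L * (1 + c ^+ 2) * (bU + 1))
      * (ey + ex) + L * ey + L * c * ex.
    by rewrite /r1; ring.
  by do ?[done|exact: sqr_ge0|apply: addr_ge0|apply: mulr_ge0].
- apply: err (momAo n); last by move=> w; exact: opnorm_ge0.
  exact/measurable_opnorm/mx_measurableB.
- apply: err (momy n); last by move=> w; exact: enorm_ge0.
  exact/measurable_enorm/mx_measurableB.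
- apply: err (momx n); last by move=> w; exact: enorm_ge0.
  exact/measurable_enorm/mx_measurableB.
Qed.

(* With exact measurements the moment bound holds for every e > 0. *)
Lemma pert_exact n : epsm = 0 -> (2 <= n)%N ->
  square_integrable P (fun w => pert n w) /\
  Ex (fun w => enorm (pert n w) ^+ 2) <= 0 ^+ 2.
Proof.
move=> e0 n2; pose G := enorm (grad (gx n) 0) + enorm (grad (gy n) 0).
have Gx : enorm (grad (gx n) 0) <= G by rewrite lerDl enorm_ge0.
have Gy : enorm (grad (gy n) 0) <= G by rewrite lerDr enorm_ge0.
pose k := perturbation_cst bU `|Lg| sigmaD (opnorm C) (opnorm D) G.
have key (e : R) : 0 < e -> e <= 1 -> square_integrable P (fun w => pert n w) /\
    Ex (fun w => enorm (pert n w) ^+ 2) <= (k * e) ^+ 2.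
  by move=> e00 e1; apply: pert_moment => //; [rewrite e00|rewrite e0 ltW].
have [sp _] := key 1 ltr01 (lexx _).
split=> //; rewrite expr0n /= leNgt; apply/negP => E0.
set E := Ex _ in key E0.
(* Chosen so that k^2 e^2 <= E / 2, which contradicts E <= (k e)^2 when E > 0; the minimum keeps e
   <= 1. *)
pose e := Num.min 1 (Num.sqrt (E / (2 * (k ^+ 2 + 1)))).
have k1 : 0 < 2 * (k ^+ 2 + 1) by rewrite mulr_gt0// ltr_wpDl ?sqr_ge0.
have e00 : 0 < e by rewrite lt_min ltr01 sqrtr_gt0 divr_gt0.
have e1 : e <= 1 by rewrite ge_min lexx.
have e2 : e ^+ 2 <= E / (2 * (k ^+ 2 + 1)).
  rewrite -[leRHS]sqr_sqrtr; last by rewrite divr_ge0 ?ltW.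
  by rewrite ler_pXn2r ?nnegrE ?sqrtr_ge0 ?(ltW e00)// ge_min lexx orbT.
have [_] := key _ e00 e1.
rewrite ler_pdivlMr// in e2; rewrite exprMn.
have := sqr_ge0 e; nra.
Qed.

End tracking.

(* MathComp-Analysis.  [bc bU Lf epsm] is the constant b of the estimate.  The
   third argument cannot be dropped: the hypotheses put no bound on the
   gradients of the costs at a point that is uniform in n, and these multiply
   the error Ao - A.  When the gradients at the origin are bounded by some G,
   the constant [bc'] depends on b_U, L_f and the other fixed data of the
   problem, but not on epsm; neither constant depends on alpha, sigmaf,
   gammab, muf, the law of Phi or the trajectory. *)
Theorem theorem2p3 (R : realType) :
  exists (bc : R -> R -> R -> R) (bc' : R -> R -> R -> R -> R -> R -> R -> R),
  forall (m d : nat) (dT dX : measure_display)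
    (T : measurableType dT) (P : probability T R) (X : measurableType dX)
    (Phi : nat -> T -> X)
    (A : X -> 'M[R]_d) (b : X -> 'cV[R]_d)
    (C D : 'M[R]_(m, d)) (r : nat -> 'cV[R]_d)
    (gx : nat -> 'cV[R]_d -> R) (gy : nat -> 'cV[R]_m -> R)
    (U : nat -> set 'cV[R]_d) (ustar : nat -> 'cV[R]_d)
    (u xhat : nat -> T -> 'cV[R]_d) (yhat : nat -> T -> 'cV[R]_m)
    (Ao : nat -> T -> 'M[R]_d)
    (mu Lg bU sigmaD epsm Lf muf sigmaf gammab alpha : R),
  let f := cost A b C D r gx gy in
  let gradf := grad_cost A b C D r gx gy in
  let F := history (u 0%N)
             (fun n w => A (Phi n w)) (fun n w => b (Phi n w)) in
  let x n w := phi_map A b (u n w) (Phi n.+1 w) in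
  let y n w := out_map C D r n (x n w) in
  let util n w := u n w - ustar n in
  let gradftil n w :=
    gradf n (u n w) (Phi n.+1 w) - gradf n (ustar n) (Phi n.+1 w) in
  (* measurability *)
  (forall n, measurable_fun setT (Phi n)) ->
  mx_measurable measurable A -> mx_measurable measurable b ->
  (forall n, mx_measurable measurable (u n)) ->
  (forall n, mx_measurable measurable (xhat n)) ->
  (forall n, mx_measurable measurable (yhat n)) ->
  (forall n, mx_measurable measurable (Ao n.+1)) ->
  (forall n, mx_measurable (F n) (u n)) ->
  (forall n, indep_of P (Phi n.+1) (F n)) ->
  (* optimizers *)
  (forall n, U n (ustar n) /\
     forall v, U n v ->
       ('E_P[fun w => f n (ustar n) (Phi n.+1 w)] <=
        'E_P[fun w => f n v (Phi n.+1 w)])%E) ->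
  (* constants of the gradient of f *)
  0 <= Lf -> 0 < muf -> 0 <= sigmaf ->
  (forall n, condE_le P (F n) (fun w => enorm (gradftil n w) ^+ 2)
     (fun w => Lf ^+ 2 * enorm (util n w) ^+ 2)) ->
  (forall n, condE_ge P (F n) (fun w => dotv (gradftil n w) (util n w))
     (fun w => muf * enorm (util n w) ^+ 2)) ->
  (forall n, condE_le P (F n)
     (fun w => enorm (gradf n (ustar n) (Phi n.+1 w)
        - expect_mx P (fun w' => gradf n (ustar n) (Phi n.+1 w'))) ^+ 2)
     (fun=> sigmaf ^+ 2)) ->
  (* (1) *)
  0 < mu ->
  (forall n, [/\ strongly_convex mu (gx n), continuously_differentiable (gx n)
     & lipschitz_grad Lg (gx n)]) ->
  (forall n, [/\ strongly_convex mu (gy n), continuously_differentiable (gy n)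
     & lipschitz_grad Lg (gy n)]) ->
  (* (2) *)
  (forall n, convex_set (U n) /\ compact (U n)) ->
  ereal_sup [set ereal_sup [set (enorm v)%:E | v in U n] |
             n in [set n | (1 <= n)%N]] = bU%:E ->
  (* (3) *)
  iid P (fun n => Phi n.+1) ->
  (forall n, condE_le P (F n) (fun w => opnorm (A (Phi n.+1 w)) ^+ 4)
     (fun=> sigmaD ^+ 4)) ->
  (forall n, condE_le P (F n) (fun w => enorm (b (Phi n.+1 w)) ^+ 4)
     (fun=> sigmaD ^+ 4)) ->
  (forall n, enorm (r n) <= sigmaD) ->
  (* (4) *)
  0 <= epsm ->
  (forall n, condE_le P (F n) (fun w => enorm (yhat n w - y n w) ^+ 4)
     (fun=> epsm ^+ 4)) ->
  (forall n, condE_le P (F n) (fun w => enorm (xhat n w - x n w) ^+ 4)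
     (fun=> epsm ^+ 4)) ->
  (forall n, condE_le P (F n)
     (fun w => opnorm (Ao n.+1 w - A (Phi n.+1 w)) ^+ 4)
     (fun=> epsm ^+ 4)) ->
  (forall n, mx_measurable (input_history xhat u n) (Ao n.+1)) ->
  (* (5) *)
  \rank (C *m expect_mx P (fun w => A (Phi 1%N w))) = d ->
  \rank (expect_mx P (fun w => A (Phi 1%N w))) = d ->
  (* the algorithm *)
  (forall n w, is_proj (U n)
     (u n w - alpha *: grad_est C gx gy n (Ao n.+1 w) (xhat n w) (yhat n w))
     (u n.+1 w)) ->
  (forall n, enorm (ustar n.+1 - ustar n) <= gammab) ->
  (* alpha < muf / Lf^2, including the degenerate case Lf = 0 *)
  0 < alpha -> alpha * Lf ^+ 2 < muf ->
  let mse N := ('E_P[fun w => (enorm (u N w - ustar N) ^+ 2)%R])%E in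
  let bound c := tracking_bound c alpha muf sigmaf epsm gammab in
  (0 < bc bU Lf epsm /\
   (limn_esup mse <= (bound (bc bU Lf epsm))%:E)%E) /\
  (forall G : R,
     (forall n, enorm (grad (gx n) 0) <= G /\ enorm (grad (gy n) 0) <= G) ->
     let c := bc' bU Lf Lg sigmaD (opnorm C) (opnorm D) G in
     0 < c /\ (limn_esup mse <= (bound c)%:E)%E).
Proof.
(* The 1 absorbs 2 sigmaf^2, and 4 Lf bU is the coefficient of sigmaf in one step, with B = 2 bU.
   The last term gives [mse_limsup_trivial]; for epsm = 0 the quotient is 0 by convention and the
   feedback error vanishes in mean square. *)
exists (fun bU Lf epsm => 1 + 4 * Lf * bU + 4 * bU ^+ 2 * Lf / epsm).
(* The last three terms match the errors of one step with xi = k epsm; 4 bU^2 Lf serves the case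
   epsm > 1. *)
exists (fun bU Lf Lg sigmaD c dn G =>
  let k := perturbation_cst bU `|Lg| sigmaD c dn G in
  1 + 4 * Lf * bU + 4 * bU ^+ 2 * Lf
  + 2 * k ^+ 2 + 4 * Lf * bU * k + 4 * bU * k).
move=> m d dT dX T P X Phi A b C D r gx gy U ustar u xhat yhat Ao.
move=> mu Lg bU sigmaD epsm Lf muf sigmaf gammab alpha f gradf F x y util gradftil.
move=> mPhi mA mb mu_ mxhat myhat mAo uF ind opt Lf0 muf0 sigmaf0.
move=> gradf_lip gradf_mono noise_le mu0 gxP gyP cUP bUP _ momA momb rP epsm0.
move=> momy momx momAo _ _ _ algo driftP alpha0 alpha_lt mse bound.
have cU n : convex_set (U n) by have [] := cUP n.
have bU0 : 0 <= bU.
  have [Us _] := opt 1%N; rewrite -lee_fin -bUP.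
  apply: (@le_trans _ _ (enorm (ustar 1%N))%:E); first by rewrite lee_fin enorm_ge0.
  apply: (@le_trans _ _ (ereal_sup [set (enorm v)%:E | v in U 1%N])).
    by apply: ereal_sup_ubound; exists (ustar 1%N).
  by apply: ereal_sup_ubound; exists 1%N.
have LU0 : 0 <= Lf * bU by exact: mulr_ge0.
have crude := mse_limsup_trivial mPhi mA mb mu_ opt Lf0 muf0 sigmaf0 gradf_lip
  gradf_mono gxP gyP bUP epsm0 algo driftP alpha0 alpha_lt.
have main := mse_limsup mPhi mA mb mu_ uF ind opt Lf0 muf0 sigmaf0 gradf_lip
  gradf_mono noise_le mu0 gxP gyP cU bUP momA momb rP epsm0 algo driftP alpha0
  alpha_lt.
have exact0 := pert_exact mPhi mA mb mu_ mxhat myhat mAo opt gxP gyP bUP momA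
  momb rP epsm0 momy momx momAo algo.
have moment := pert_moment mPhi mA mb mu_ mxhat myhat mAo opt gxP gyP bUP momA
  momb rP epsm0 momy momx momAo algo.
have s2 : 0 <= sigmaf ^+ 2 by exact: sqr_ge0.
have e2 : 0 <= epsm ^+ 2 by exact: sqr_ge0.
have al2 : 0 <= alpha ^+ 2 by exact: sqr_ge0.
have b2L : 0 <= 4 * bU ^+ 2 * Lf by rewrite !mulr_ge0// sqr_ge0.
have exact_bound bc : epsm = 0 -> 1 + 4 * Lf * bU <= bc ->
    (limn_esup mse <= (bound bc)%:E)%E.
  move=> e0 hbc; apply: (main bc 0) => //; first lra.
    by move=> n n2; exact: exact0.
  have bc1 : 1 <= bc by lra.
  have bcL : 4 * (Lf * bU) <= bc by lra.
  have h1 := ler_wpM2r s2 bc1; have h2 := ler_wpM2r sigmaf0 bcL.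
  have h3 := ler_wpM2l al2 (lerD h1 h2).
  have h4 := ler_wpM2l al2 h1.
  by rewrite e0; lra.
split.
  have bc0 : 0 < 1 + 4 * Lf * bU + 4 * bU ^+ 2 * Lf / epsm.
    by have := divr_ge0 b2L epsm0; lra.
  split=> //; have [e0|e0] := eqVneq epsm 0.
    by apply: exact_bound => //; rewrite lerDl divr_ge0.
  have e00 : 0 < epsm by rewrite lt0r e0.
  apply: crude => //; rewrite [leRHS]mulrDl divfK// lerDr mulr_ge0//; lra.
move=> G hG c.
pose k := perturbation_cst bU `|Lg| sigmaD (opnorm C) (opnorm D) G.
have k1 : 1 <= k by exact: perturbation_cst_ge1.
have k0 : 0 <= k by lra.
have k2 : 0 <= k ^+ 2 by exact: sqr_ge0.
have LUk : 0 <= Lf * bU * k by exact: mulr_ge0.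
have Uk : 0 <= bU * k by exact: mulr_ge0.
have cE : c = 1 + 4 * Lf * bU + 4 * bU ^+ 2 * Lf
  + 2 * k ^+ 2 + 4 * Lf * bU * k + 4 * bU * k by [].
have c0 : 0 < c by rewrite cE; lra.
split=> //; have [e0|e0] := eqVneq epsm 0.
  by apply: exact_bound => //; rewrite cE; lra.
have e00 : 0 < epsm by rewrite lt0r e0.
have [e1|e1] := leP epsm 1; last first.
  apply: crude => //; apply: (@le_trans _ _ c); first by rewrite cE; lra.
  by rewrite ler_peMr// ltW.
have ke0 : 0 <= k * epsm by exact: mulr_ge0.
apply: (main c (k * epsm)) => //.
  by move=> n n2; have [Gx Gy] := hG n; apply: moment => //; rewrite e00.
have c1 : 1 <= c by rewrite cE; lra.
have cL : 4 * (Lf * bU) <= c by rewrite cE; lra.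
have ck2 : 2 * k ^+ 2 <= c by rewrite cE; lra.
have cLk : 4 * (Lf * bU * k) <= c by rewrite cE; lra.
have cUk : 4 * (bU * k) <= c by rewrite cE; lra.
have h1 := ler_wpM2r s2 c1; have h2 := ler_wpM2r sigmaf0 cL.
have h3 := ler_wpM2r e2 ck2; have h4 := ler_wpM2r epsm0 cLk.
have h5 := ler_wpM2l (ltW alpha0) (ler_wpM2r epsm0 cUk).
have h6 := ler_wpM2l al2 (lerD (lerD h1 h2) (lerD h3 h4)).
have h7 : 0 <= alpha ^+ 2 * (c * epsm ^+ 2).
  by apply: mulr_ge0 => //; apply: mulr_ge0 => //; exact: ltW.
have h8 := ler_wpM2l al2 h1.
lra.
Qed.
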